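(* For $i=1,2$ let $\mathcal{H}_i$ be a $2$-interpolating Hilbert function space with maximal domain $X_i\subseteq\mathbb{C}^{d_i}$, $d_i\in\mathbb{N}$. Assume that $\operatorname{int}(X_i)$ is connected and dense in $X_i$, and that every function in $\mathcal{H}_i$ is holomorphic on $\operatorname{int}(X_i)$ and continuous on $X_i$ ($i=1,2$). Furthermore, assume that the polynomials form a dense subset of $\mathcal{H}_1$, that $\mathcal{H}_2$ contains the constants and the coordinate functions, and that $d_1\ge d_2$. If $W_{\lambda,\varphi}:\mathcal{H}_2\to\mathcal{H}_1$ is an invertible weighted composition operator, then (1) $d_1=d_2$, (2) $\varphi:X_1\to X_2$ is a bijection which is holomorphic on the interior of $X_1$ and continuous on $X_1$, (3) $W_{\lambda,\varphi}^{-1}=W_{1/(\lambda\circ\varphi^{-1}),\,\varphi^{-1}}$.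
   Context: A Hilbert function space on a set $X$ is a Hilbert space $\mathcal{H}$ of complex functions on $X$ all of whose point evaluations are bounded; $k_x\in\mathcal{H}$ is the vector with $f(x)=\langle f,k_x\rangle$ for all $f\in\mathcal{H}$. $\mathcal{H}$ is $2$-interpolating if for any two distinct points $x,y\in X$ the vectors $k_x,k_y$ are linearly independent. A nonzero bounded linear functional $\rho$ on $\mathcal{H}$ is multiplicative if $\rho(fg)=\rho(f)\rho(g)$ whenever $f,g$ and $fg$ are in $\mathcal{H}$. $X$ is a maximal domain for $\mathcal{H}$ if for every multiplicative functional $\rho$ on $\mathcal{H}$ there is $x\in X$ with $\rho(f)=f(x)$ for all $f\in\mathcal{H}$. For Hilbert function spaces $\mathcal{H}_i$ on $X_i$, a weighted composition operator $W_{\lambda,\varphi}:\mathcal{H}_2\to\mathcal{H}_1$ is a bounded operator $f\mapsto\lambda\,(f\circ\varphi)$ with $\varphi:X_1\to X_2$ and $\lambda:X_1\to\mathbb{C}$; it is invertible if it is a bounded bijection (its inverse is not assumed to be a weighted composition operator). *)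

(* Defs.v *)
(* Plain `Require' for mpoly: its notations clash with those of analysis. *)
From HB Require Import structures.
From mathcomp Require Import all_boot all_order all_algebra.
From mathcomp Require Import complex.
From mathcomp Require mpoly.
From mathcomp Require Import all_classical all_reals all_analysis.
Import Order.TTheory GRing.Theory Num.Theory numFieldNormedType.Exports.
Set Implicit Arguments.
Unset Strict Implicit.
Unset Printing Implicit Defensive.
Local Open Scope classical_set_scope.
Local Open Scope ring_scope.
Local Open Scope complex_scope.

(* Naming R[i] with its field structure as sort lets the generic topology and
   norm of a numClosedFieldType be inferred on C and on row vectors over C. *)
Definition Cplx (R : realType) : numClosedFieldType := R[i].

Definition bounded_map (K : numFieldType) (V W : normedModType K)
  (T : V -> W) : Prop :=
  exists M : K, forall v : V, `|T v| <= M * `|v|.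

(* A Hilbert space of functions on X is presented as a complete normed space
   whose norm comes from an inner product (linear in the first variable),
   together with an injective linear map hfs_fun reading vectors as functions
   on X. *)
Record hilbertFunctionSpace (R : realType) (X : Type) := HilbertFunctionSpace {
  hfs_sort :> completeNormedModType (Cplx R) ;
  hfs_dot : {dot hfs_sort for @Num.conj (Cplx R)} ;
  hfs_normE : forall f : hfs_sort, `|f| ^+ 2 = hfs_dot f f ;
  hfs_fun : hfs_sort -> X -> Cplx R ;
  hfs_fun_linear : forall (a : Cplx R) (f g : hfs_sort) (x : X),
    hfs_fun (a *: f + g) x = a * hfs_fun f x + hfs_fun g x ;
  hfs_fun_inj : injective hfs_fun ;
  hfs_fun_bounded : forall x : X, bounded_map (hfs_fun^~ x)
}.

Section HilbertFunctionSpaces.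
Variables (R : realType) (X : Type) (H : hilbertFunctionSpace R X).

(* The vector k_x; it exists and is unique by the Riesz representation
   theorem, so the default value 0 of xget is never used. *)
Definition hfs_kernel (x : X) : H :=
  xget 0 [set k : H | forall f : H, hfs_fun f x = hfs_dot H f k].

Definition linearly_independent2 (u v : H) : Prop :=
  forall a b : Cplx R, a *: u + b *: v = 0 -> a = 0 /\ b = 0.

Definition two_interpolating : Prop :=
  forall x y : X, x <> y ->
    linearly_independent2 (hfs_kernel x) (hfs_kernel y).

Definition multiplicative_functional (rho : {linear H -> Cplx R}) : Prop :=
  [/\ bounded_map rho,
      exists f : H, rho f != 0 &
      forall f g h : H, (forall x, hfs_fun h x = hfs_fun f x * hfs_fun g x) ->
        rho h = rho f * rho g].

Definition maximal_domain : Prop :=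
  forall rho : {linear H -> Cplx R}, multiplicative_functional rho ->
    exists x : X, forall f : H, rho f = hfs_fun f x.

End HilbertFunctionSpaces.

Definition weighted_composition_operator (R : realType) (X1 X2 : Type)
    (H1 : hilbertFunctionSpace R X1) (H2 : hilbertFunctionSpace R X2)
    (lambda : X1 -> Cplx R) (phi : X1 -> X2) (W : H2 -> H1) : Prop :=
  [/\ linear W,
      bounded_map W &
      forall (f : H2) (x : X1), hfs_fun (W f) x = lambda x * hfs_fun f (phi x)].

(* valL_ 0 f extends f by 0 outside X; at an interior point of X the choice of
   extension is irrelevant.  `differentiable' is Frechet differentiability
   over the scalar field, hence complex differentiability here. *)
Definition holomorphic_on_interior (R : realType) (d : nat)
    (X : set 'rV[Cplx R]_d) (V : normedModType (Cplx R)) (f : X -> V) : Prop :=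
  forall z : 'rV[Cplx R]_d, X° z -> differentiable (valL_ 0 f) z.

Definition coord_fun (R : realType) (d : nat) (X : set 'rV[Cplx R]_d)
  (i : 'I_d) (x : X) : Cplx R := set_val x ord0 i.

Definition poly_fun (R : realType) (d : nat) (X : set 'rV[Cplx R]_d)
    (p : mpoly.mpoly d (Cplx R)) (x : X) : Cplx R :=
  mpoly.meval (fun i => coord_fun i x) p.

(* Main.v *)
Require Import Defs.
From HB Require Import structures.
From mathcomp Require Import all_boot all_order all_algebra.
From mathcomp Require Import complex.
From mathcomp Require mpoly.
From mathcomp Require Import all_classical all_reals all_analysis.
From mathcomp Require Import ring lra.
Import Order.TTheory GRing.Theory Num.Theory numFieldNormedType.Exports.
Set Implicit Arguments.
Unset Strict Implicit.
Unset Printing Implicit Defensive.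
Local Open Scope classical_set_scope.
Local Open Scope ring_scope.
Local Open Scope complex_scope.

(** Write [N] for the inverse of [W].  Applied to the polynomials [1] and
    [z_k], surjectivity of [W] gives [f0], [fk] in [H2] with
    [lambda * (f0 o phi) = 1] and [lambda * (fk o phi) = z_k]; hence [lambda]
    has no zero, and [fk / f0] is a continuous left inverse of [phi]
    (lemma [left_inverse_coord]).  Applied to the functions [1] and [z_i] of
    [H2], [W] gives [lambda] and [lambda * phi_i], which lie in [H1], so that
    [phi] is continuous, and holomorphic inside (lemmas [phi_continuous] and
    [phi_holomorphic]).

    The equality of dimensions needs a point of the interior of [X1] where the
    derivative of [phi] is injective ([nonsingular_point]).  If there were
    none, every derivative of [phi] would have a kernel vector whose largest
    coordinate is [1]; finitely many coordinates compete for being this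
    largest one, so on some ball the same coordinate [k] works at all points.
    Following these kernel vectors in small steps (an Euler polygon) moves the
    [k]-th coordinate by a fixed amount and [phi] by an arbitrarily small one,
    which the continuous left inverse forbids.  Then [d1 <= d2], so the
    derivative is invertible at that point and, by Newton's iteration
    ([local_surjectivity]), the image of [phi] contains a ball.

    Surjectivity of [phi] is the heart of the matter.  For [y] in [X2] the
    functional [f |-> (N f)(y) / f0(y)] on [H1] is multiplicative: if
    [h = f * g] then [N f * N g = N h * f0] on the image of [phi], thus on a
    ball, and therefore everywhere by the identity theorem, connectedness of
    the interior of [X2] and its density ([product_identity]).  The same
    identity for [f = g] a polynomial shows that [f0(y) <> 0]: otherwise [N p]
    would vanish at [y] for all polynomials [p], hence [N f] would for all
    [f], although [1] is in the range of [N].  Maximality of [X1] now produces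
    [x] with [(N f)(y) / f0(y) = f(x)], and inserting [W 1] and [W z_i] for
    [f] shows [y = phi x].  The functional is bounded because [N] is, by the
    open mapping principle ([bounded_inverse]).

    Two facts about complex differentiable functions enter: the identity
    theorem, and a locally uniform second-order Taylor bound, which makes
    the derivatives locally Lipschitz.  Both follow from Cauchy's formula on
    squares; only complex differentiability is assumed, so the formula is
    derived from Goursat's theorem for rectangles.  Several variables are
    reduced to one by restricting to complex lines. *)

(** * Real-valued norms *)

Section RealNorm.
Variable R : realType.
Local Notation C := (Cplx R).

(** Norms over the complex numbers are themselves complex numbers, only
    partially ordered; estimates are carried out on their real parts. *)
Definition rnorm (V : normedZmodType C) (v : V) : R := complex.Re `|v|.

Lemma rnormE (V : normedZmodType C) (v : V) : `|v| = (rnorm v)%:C :> C.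
Proof.
rewrite /rnorm; have := normr_ge0 v.
by case: `|v| => a b; rewrite lecE /= => /andP[/eqP-> _].
Qed.

Lemma rnorm_ge0 (V : normedZmodType C) (v : V) : 0 <= rnorm v.
Proof. by have := normr_ge0 v; rewrite rnormE lecE /= eqxx. Qed.

Lemma rnorm0 (V : normedZmodType C) : rnorm (0 : V) = 0.
Proof. by rewrite /rnorm normr0. Qed.

Lemma rnorm_eq0 (V : normedZmodType C) (v : V) : rnorm v = 0 -> v = 0.
Proof. by move=> v0; apply/eqP; rewrite -normr_eq0 rnormE v0. Qed.

Lemma rnorm_gt0 (V : normedZmodType C) (v : V) : v != 0 -> 0 < rnorm v.
Proof.
move=> v0; rewrite lt_neqAle rnorm_ge0 andbT eq_sym.
by apply: contra v0 => /eqP/rnorm_eq0 ->.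
Qed.

Lemma rnormN (V : normedZmodType C) (v : V) : rnorm (- v) = rnorm v.
Proof. by rewrite /rnorm normrN. Qed.

Lemma rnormD (V : normedZmodType C) (u v : V) :
  rnorm (u + v) <= rnorm u + rnorm v.
Proof.
by have := ler_normD u v; rewrite !rnormE lecE /= => /andP[_].
Qed.

Lemma rnormB (V : normedZmodType C) (u v : V) :
  rnorm (u - v) <= rnorm u + rnorm v.
Proof. by rewrite -[leRHS]/(rnorm u + _) -(rnormN v) rnormD. Qed.

Lemma rdistC (V : normedZmodType C) (u v : V) : rnorm (u - v) = rnorm (v - u).
Proof. by rewrite -rnormN opprB. Qed.

Lemma rdist_triangle (V : normedZmodType C) (v u w : V) :
  rnorm (u - w) <= rnorm (u - v) + rnorm (v - w).
Proof. by rewrite -[u - w](subrKA v) rnormD. Qed.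

Lemma rnormZ (V : normedModType C) (a : C) (v : V) :
  rnorm (a *: v) = rnorm a * rnorm v.
Proof.
by rewrite /rnorm normrZ !rnormE /= mulr0 subr0.
Qed.

Lemma rnormM (a b : C) : rnorm (a * b) = rnorm a * rnorm b.
Proof. by rewrite /rnorm normrM !rnormE /= mulr0 subr0. Qed.

Lemma rnorm1 : rnorm (1 : C) = 1.
Proof. by rewrite /rnorm normr1. Qed.

Lemma rnormX (a : C) n : rnorm (a ^+ n) = rnorm a ^+ n.
Proof. by elim: n => [|n IH]; rewrite ?rnorm1// !exprS rnormM IH. Qed.

Lemma rnormV (a : C) : rnorm a^-1 = (rnorm a)^-1.
Proof.
have [->|a0] := eqVneq a 0; first by rewrite invr0 rnorm0 invr0.
have ra : rnorm a != 0 by rewrite gt_eqF// rnorm_gt0.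
by apply: (mulfI ra); rewrite -rnormM !divff// rnorm1.
Qed.

Lemma rnorm_real (a : R) : rnorm (a%:C : C) = `|a|.
Proof. by rewrite /rnorm normc_def /= expr0n/= addr0 sqrtr_sqr. Qed.

Lemma rnorm_pos (a : R) : 0 <= a -> rnorm (a%:C : C) = a.
Proof. by move=> a0; rewrite rnorm_real ger0_norm. Qed.

Lemma rnorm_i : rnorm ('i : C) = 1.
Proof. by rewrite /rnorm normc_def /= expr0n expr1n/= add0r sqrtr1. Qed.

Lemma rnorm_sq (z : C) : rnorm z ^+ 2 = complex.Re z ^+ 2 + complex.Im z ^+ 2.
Proof.
by rewrite /rnorm normc_def /= sqr_sqrtr// addr_ge0// sqr_ge0.
Qed.

Lemma Re_le_rnorm (z : C) : `|complex.Re z| <= rnorm z.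
Proof.
rewrite -ler_sqr ?nnegrE ?rnorm_ge0// rnorm_sq real_normK ?num_real//.
by rewrite lerDl sqr_ge0.
Qed.

Lemma Im_le_rnorm (z : C) : `|complex.Im z| <= rnorm z.
Proof.
rewrite -ler_sqr ?nnegrE ?rnorm_ge0// rnorm_sq real_normK ?num_real//.
by rewrite lerDr sqr_ge0.
Qed.

Lemma rnorm_le_ReIm (z : C) : rnorm z <= `|complex.Re z| + `|complex.Im z|.
Proof.
rewrite -ler_sqr ?nnegrE ?rnorm_ge0 ?addr_ge0//.
rewrite rnorm_sq sqrrD !real_normK ?num_real//.
by rewrite lerD2r lerDl mulrn_wge0// mulr_ge0.
Qed.

Lemma bounded_mapP (V W : normedModType C) (T : V -> W) :
  bounded_map T <-> exists M : R, forall v, rnorm (T v) <= M * rnorm v.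
Proof.
split=> -[M TM].
  exists (complex.Re M) => v; have := TM v; rewrite !rnormE.
  by case: M {TM} => a b; rewrite lecE /= !mulr0 subr0 => /andP[_].
exists M%:C => v; rewrite !rnormE lecE /= !(mulr0, mul0r) addr0 subr0 eqxx/=.
exact: TM.
Qed.

Lemma nbhs_rballP (V : normedModType C) (x : V) (A : set V) :
  nbhs x A <-> exists2 e : R, 0 < e & forall y, rnorm (y - x) < e -> A y.
Proof.
split.
  case/nbhs_ballP => e /= e0 eA.
  have [/= Ie Re] : complex.Im e = 0 /\ 0 < complex.Re e.
    by move: e0; rewrite ltcE /= => /andP[/eqP-> ->].
  exists (complex.Re e) => // y yx; apply: eA.
  rewrite -ball_normE /= distrC rnormE.
  by case: e {e0} Ie Re yx => a b /= -> a0 yx; rewrite ltcE /= eqxx.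
move=> [e e0 eA]; apply/nbhs_ballP; exists e%:C => /=.
  by rewrite ltcE /= eqxx.
move=> y; rewrite -ball_normE /= distrC rnormE ltcE /= => /andP[_].
exact: eA.
Qed.

Lemma cvg_rnormP (T : topologicalType) (V : normedModType C) (x : T)
    (f : T -> V) (l : V) :
  f @ x --> l <-> forall e : R, 0 < e -> \forall y \near x, rnorm (f y - l) < e.
Proof.
split=> [fl e e0|fl A /nbhs_rballP[e e0 eA]].
  by apply: (fl [set y | rnorm (y - l) < e]); apply/nbhs_rballP; exists e.
by apply: filterS (fl e e0) => y; exact: eA.
Qed.

Lemma continuous_rnormP (V W : normedModType C) (x : V) (f : V -> W) :
  {for x, continuous f} <->
  forall e : R, 0 < e -> exists2 d : R, 0 < d &
    forall y, rnorm (y - x) < d -> rnorm (f y - f x) < e.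
Proof.
rewrite /prop_for /continuous_at cvg_rnormP.
by split=> fx e /fx /nbhs_rballP.
Qed.

Lemma openP_rball (V : normedModType C) (A : set V) (x : V) : open A -> A x ->
  exists2 e : R, 0 < e & forall y, rnorm (y - x) < e -> A y.
Proof. by move=> oA Ax; apply/nbhs_rballP; exact: open_nbhs_nbhs. Qed.

Lemma open_rball (V : normedModType C) (x : V) (r : R) :
  open [set y | rnorm (y - x) < r].
Proof.
rewrite openE => y /= yx; apply/nbhs_rballP; exists (r - rnorm (y - x)).
  by rewrite subr_gt0.
move=> z zy /=; have := rdist_triangle y z x; lra.
Qed.

End RealNorm.

(** * Sequences with geometrically decreasing steps *)

Section GeometricSequences.
Variable R : realType.
Local Notation C := (Cplx R).

Lemma geom_lt (M e : R) : 0 < e -> exists n, M * 2^-1 ^+ n < e.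
Proof.
move=> e0; pose N := (Num.truncn (M / e)).+1; exists N.
have MN : M / e < N%:R by exact: truncnS_gt.
have N2 : N%:R <= 2 ^+ N :> R by rewrite -natrX ler_nat ltnW// ltn_expl.
rewrite exprVn ltr_pdivrMr ?exprn_gt0// -ltr_pdivrMl//.
by rewrite mulrC; apply: lt_le_trans MN N2.
Qed.

Lemma le_geom (M a b : R) : (forall n, a <= b + M * 2^-1 ^+ n) -> a <= b.
Proof.
move=> ab; rewrite leNgt; apply/negP => ba.
have [n] := @geom_lt M (a - b) ltac:(by rewrite subr_gt0).
by rewrite ltrBrDl ltNge ab.
Qed.

(** With [q n := 2 * M / 2 ^ n], the sequence [u n - q n] increases and [u n + q n]
    decreases, so the supremum of the former lies between them. *)
Lemma geom_complete_real (u : nat -> R) (M : R) :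
  (forall n, `|u n.+1 - u n| <= M * 2^-1 ^+ n) ->
  exists l, forall n, `|u n - l| <= 2 * M * 2^-1 ^+ n.
Proof.
move=> uM; pose q n : R := 2 * M * 2^-1 ^+ n.
have qS n : q n.+1 = q n - M * 2^-1 ^+ n by rewrite /q exprS; field.
have lo n : u n - q n <= u n.+1 - q n.+1.
  by rewrite qS; have := uM n; rewrite ler_norml => /andP[]; lra.
have hi n : u n.+1 + q n.+1 <= u n + q n.
  by rewrite qS; have := uM n; rewrite ler_norml => /andP[]; lra.
have q0 n : 0 <= q n.
  rewrite /q -mulrA mulr_ge0// (le_trans _ (uM n))//.
have los n m : u n - q n <= u (n + m)%N - q (n + m)%N.
  by elim: m => [|m IH]; rewrite ?addn0// addnS (le_trans IH).
have his n m : u (n + m)%N + q (n + m)%N <= u n + q n.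
  by elim: m => [|m IH]; rewrite ?addn0// addnS (le_trans (hi _)).
have lohi n m : u n - q n <= u m + q m.
  have h1 := los n m; have h2 := his m n; rewrite addnC in h2.
  by have := q0 (n + m)%N; lra.
pose S : set R := range (fun n => u n - q n).
have S0 : S !=set0 by exists (u 0%N - q 0%N), 0%N.
exists (sup S) => n; rewrite -/(q n).
have l1 : u n - q n <= sup S.
  apply: ub_le_sup; last by exists n.
  by exists (u 0%N + q 0%N) => _ [m _ <-]; exact: lohi.
have l2 : sup S <= u n + q n.
  by apply: ge_sup => // _ [m _ <-]; exact: lohi.
by rewrite ler_norml; apply/andP; split; lra.
Qed.

Lemma geom_complete_C (u : nat -> C) (M : R) :
  (forall n, rnorm (u n.+1 - u n) <= M * 2^-1 ^+ n) ->
  exists l, forall n, rnorm (u n - l) <= 4 * M * 2^-1 ^+ n.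
Proof.
move=> uM.
have [a ua] : exists l, forall n, `|complex.Re (u n) - l| <= 2 * M * 2^-1 ^+ n.
  apply: geom_complete_real => n; apply: le_trans (uM n).
  have -> : complex.Re (u n.+1) - complex.Re (u n) = complex.Re (u n.+1 - u n).
    by case: (u n.+1) (u n) => ? ? [].
  exact: Re_le_rnorm.
have [b ub] : exists l, forall n, `|complex.Im (u n) - l| <= 2 * M * 2^-1 ^+ n.
  apply: geom_complete_real => n; apply: le_trans (uM n).
  have -> : complex.Im (u n.+1) - complex.Im (u n) = complex.Im (u n.+1 - u n).
    by case: (u n.+1) (u n) => ? ? [].
  exact: Im_le_rnorm.
exists (a +i* b) => n; apply: le_trans (rnorm_le_ReIm _) _.
have := ua n; have := ub n; case: (u n) => x y /=.
set p := _ ^+ n; lra.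
Qed.

Lemma geom_dist (V : normedModType C) (u : nat -> V) (M : R) :
  (forall n, rnorm (u n.+1 - u n) <= M * 2^-1 ^+ n) ->
  forall n m, rnorm (u (n + m)%N - u n) <= 2 * M * 2^-1 ^+ n.
Proof.
move=> uM n m.
have M0 : 0 <= M by have := uM 0%N; rewrite expr0 mulr1; apply: le_trans; exact: rnorm_ge0.
have H k : rnorm (u (n + k)%N - u n) <= 2 * M * 2^-1 ^+ n * (1 - 2^-1 ^+ k).
  elim: k => [|k IH]; first by rewrite addn0 !subrr rnorm0 mulr0.
  rewrite addnS; apply: le_trans (rdist_triangle (u (n + k)%N) _ _) _.
  apply: le_trans (lerD (uM _) IH) _.
  rewrite exprD [_ ^+ k.+1]exprS.
  set p := _ ^+ n; set q := _ ^+ k; rewrite le_eqVlt; apply/orP; left; apply/eqP.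
  by field.
apply: le_trans (H m) _.
rewrite -[leRHS]mulr1; apply: ler_wpM2l.
  by rewrite !mulr_ge0// exprn_ge0// invr_ge0.
by rewrite lerBlDr lerDl exprn_ge0// invr_ge0.
Qed.

Lemma geom_complete_Banach (V : completeNormedModType C) (u : nat -> V) (M : R) :
  (forall n, rnorm (u n.+1 - u n) <= M * 2^-1 ^+ n) ->
  exists l, forall n, rnorm (u n - l) <= 2 * M * 2^-1 ^+ n.
Proof.
move=> uM; have ud := geom_dist uM.
have cu : cvg (u @ \oo).
  apply/cauchy_cvgP/cauchy_exP => e e0.
  have e0' : 0 < complex.Re e by move: e0; rewrite ltcE => /andP[].
  have [n nM] := geom_lt (2 * M) e0'.
  exists (u n), n => // m /= nm; rewrite -ball_normE /= distrC rnormE.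
  have := ud n (m - n)%N; rewrite subnKC// => /le_lt_trans/(_ nM).
  move: e0; rewrite !ltcE /= => /andP[/eqP-> _].
  by rewrite eqxx.
move/cvg_ex: cu => [l ul]; exists l => n.
apply/ler_addgt0Pr => e e0.
have Nl : nbhs l [set y | rnorm (y - l) < e] by apply/nbhs_rballP; exists e.
have [N _ HN] := ul _ Nl.
have := HN (n + N)%N (leq_addl _ _) => /= h1.
have h2 := ud n N; rewrite rdistC in h2.
by have := rdist_triangle (u (n + N)%N) (u n) l; lra.
Qed.

End GeometricSequences.

(** * Integrals of complex-valued functions of a real variable *)

Section ComplexIntegral.
Variable R : realType.
Local Notation C := (Cplx R).
Local Notation mu := (@lebesgue_measure R).
Implicit Types (g : R -> C) (a b t m : R).

Definition cont_at (g : R -> C) (t : R) := forall e : R, 0 < e ->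
  exists2 d : R, 0 < d & forall s, `|s - t| < d -> rnorm (g s - g t) < e.

Definition cont_on (g : R -> C) (a b : R) :=
  forall t, a <= t <= b -> cont_at g t.

Definition Cint (g : R -> C) (a b : R) : C :=
  (\int[mu]_(t in `[a, b]) complex.Re (g t)) +i*
  (\int[mu]_(t in `[a, b]) complex.Im (g t)).

Lemma ReB (x y : C) : complex.Re (x - y) = complex.Re x - complex.Re y.
Proof. by case: x y => ? ? []. Qed.
Lemma ImB (x y : C) : complex.Im (x - y) = complex.Im x - complex.Im y.
Proof. by case: x y => ? ? []. Qed.
Lemma ReD (x y : C) : complex.Re (x + y) = complex.Re x + complex.Re y.
Proof. by case: x y => ? ? []. Qed.
Lemma ImD (x y : C) : complex.Im (x + y) = complex.Im x + complex.Im y.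
Proof. by case: x y => ? ? []. Qed.

Lemma eps_delta_integrable (h : R -> R) a b :
  (forall t, a <= t <= b -> forall e : R, 0 < e ->
    exists2 d : R, 0 < d & forall s, `|s - t| < d -> `|h s - h t| < e) ->
  mu.-integrable `[a, b] (EFin \o h).
Proof.
move=> hc; apply: continuous_compact_integrable; first exact: segment_compact.
apply: continuous_in_subspaceT => t; rewrite inE /= in_itv /= => /hc tc.
apply/cvgrPdist_lt => e /tc[d d0 hd].
apply/nbhs_ballP; exists d => //= s; rewrite /ball /= distrC => /hd.
by rewrite distrC.
Qed.

Lemma Re_integrable g a b : cont_on g a b ->
  mu.-integrable `[a, b] (EFin \o (fun t => complex.Re (g t))).
Proof.
move=> gc; apply: eps_delta_integrable => t /gc tc e /tc[d d0 hd].
exists d => // s /hd; apply: le_lt_trans.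
by rewrite -ReB; exact: Re_le_rnorm.
Qed.

Lemma Im_integrable g a b : cont_on g a b ->
  mu.-integrable `[a, b] (EFin \o (fun t => complex.Im (g t))).
Proof.
move=> gc; apply: eps_delta_integrable => t /gc tc e /tc[d d0 hd].
exists d => // s /hd; apply: le_lt_trans.
by rewrite -ImB; exact: Im_le_rnorm.
Qed.

Lemma Cint_split g a m b : a <= m <= b -> cont_on g a b ->
  Cint g a b = Cint g a m + Cint g m b.
Proof.
move=> /andP[am mb] gc.
have gam : cont_on g a m by move=> t /andP[at_ tm]; apply: gc; rewrite at_ (le_trans tm).
have gmb : cont_on g m b by move=> t /andP[mt tb]; apply: gc; rewrite tb (le_trans am).
have S (h : R -> R) : mu.-integrable `[a, b] (EFin \o h) ->
  mu.-integrable `[m, b] (EFin \o h) ->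
   \int[mu]_(t in `[a, b]) h t =
   \int[mu]_(t in `[a, m]) h t + \int[mu]_(t in `[m, b]) h t.
  move=> hi hi'.
  rewrite -(@Rintegral_itv_obnd_cbnd _ m (BRight b) h).
    rewrite -(@Rintegral_itvB _ h (BLeft a) (BRight b) m)//.
    by rewrite addrC subrK.
  by apply: integrableS hi' => //; apply: subset_itv_oc_cc.
apply/eqP; rewrite eq_complex /=; apply/andP; split; apply/eqP; apply: S.
- exact: Re_integrable.
- exact: Re_integrable.
- exact: Im_integrable.
- exact: Im_integrable.
Qed.

Lemma CintD g1 g2 a b : cont_on g1 a b -> cont_on g2 a b ->
  Cint (fun t => g1 t + g2 t) a b = Cint g1 a b + Cint g2 a b.
Proof.
move=> c1 c2; rewrite /Cint; apply/eqP; rewrite eq_complex /=.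
apply/andP; split; apply/eqP.
  rewrite -RintegralD//; [|exact: Re_integrable..].
  by apply: eq_Rintegral => t _; rewrite ReD.
rewrite -RintegralD//; [|exact: Im_integrable..].
by apply: eq_Rintegral => t _; rewrite ImD.
Qed.

Lemma CintZ (c : C) g a b : cont_on g a b ->
  Cint (fun t => c * g t) a b = c * Cint g a b.
Proof.
move=> gc; rewrite /Cint; case: c => x y.
have I1 := Re_integrable gc; have I2 := Im_integrable gc.
have Z (h : R -> R) (k : R) : mu.-integrable `[a, b] (EFin \o h) ->
  mu.-integrable `[a, b] (EFin \o (fun t => k * h t)).
  move=> /(@integrableZl _ _ _ mu `[a, b] _ k) H.
  by rewrite (_ : EFin \o _ = fun t => (k%:E * (EFin \o h) t)%E); [exact: H|].
apply/eqP; rewrite eq_complex /=; apply/andP; split; apply/eqP.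
  rewrite -!RintegralZl// -RintegralB//; try exact: Z.
  by apply: eq_Rintegral => t _; case: (g t).
rewrite -!RintegralZl// -RintegralD//; try exact: Z.
by apply: eq_Rintegral => t _; case: (g t).
Qed.

Lemma eq_Cint g1 g2 a b : (forall t, a <= t <= b -> g1 t = g2 t) ->
  Cint g1 a b = Cint g2 a b.
Proof.
by move=> g12; congr (_ +i* _); apply: eq_Rintegral => t;
  rewrite inE /= in_itv /= => /g12 ->.
Qed.

Lemma lebesgue_measure_cc a b : a <= b -> fine (mu `[a, b]) = b - a.
Proof.
move=> ab; rewrite lebesgue_measure_itv /= lte_fin.
by case: ltgtP ab => // -> _; rewrite subrr.
Qed.

Lemma Cint_cst (c : C) a b : a <= b -> Cint (fun=> c) a b = (b - a)%:C * c.
Proof.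
move=> ab; rewrite /Cint !Rintegral_cst//= lebesgue_measure_cc//.
by case: c => x y /=; apply/eqP; rewrite eq_complex /= !mul0r subr0 addr0 ![_ * (b - a)]mulrC !eqxx.
Qed.

Lemma Rintegral_bound (h : R -> R) a b (M : R) : a <= b ->
  mu.-integrable `[a, b] (EFin \o h) ->
  (forall t, a <= t <= b -> `|h t| <= M) ->
  `|\int[mu]_(t in `[a, b]) h t| <= M * (b - a).
Proof.
move=> ab hi hM; apply: le_trans (le_normr_Rintegral _ hi) _ => //.
rewrite -(lebesgue_measure_cc ab) -Rintegral_cst//.
apply: le_Rintegral => //.
- exact: integrable_norm.
- by apply: eps_delta_integrable => t _ e e0; exists 1 => // s _; rewrite subrr normr0.
Qed.

(** The factor 2 comes from bounding real and imaginary parts separately. *)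
Lemma Cint_bound g a b (M : R) : a <= b -> cont_on g a b ->
  (forall t, a <= t <= b -> rnorm (g t) <= M) ->
  rnorm (Cint g a b) <= 2 * M * (b - a).
Proof.
move=> ab gc gM; apply: le_trans (rnorm_le_ReIm _) _ => /=.
rewrite -mulrA mulr_natl mulr2n; apply: lerD.
  apply: Rintegral_bound => //; first exact: Re_integrable.
  by move=> t /gM; apply: le_trans; exact: Re_le_rnorm.
apply: Rintegral_bound => //; first exact: Im_integrable.
by move=> t /gM; apply: le_trans; exact: Im_le_rnorm.
Qed.

Lemma Rintegral_ge (h : R -> R) a b (m : R) : a <= b ->
  mu.-integrable `[a, b] (EFin \o h) ->
  (forall t, a <= t <= b -> m <= h t) ->
  m * (b - a) <= \int[mu]_(t in `[a, b]) h t.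
Proof.
move=> ab hi hm; rewrite -(lebesgue_measure_cc ab) -Rintegral_cst//.
apply: le_Rintegral => //.
  by apply: eps_delta_integrable => t _ e e0; exists 1 => // s _; rewrite subrr normr0.
Qed.

Lemma Im_Cint_ge g a b (m : R) : a <= b -> cont_on g a b ->
  (forall t, a <= t <= b -> m <= complex.Im (g t)) ->
  m * (b - a) <= complex.Im (Cint g a b).
Proof. by move=> ab /Im_integrable gi gm; exact: Rintegral_ge. Qed.

Lemma Re_Cint_ge g a b (m : R) : a <= b -> cont_on g a b ->
  (forall t, a <= t <= b -> m <= complex.Re (g t)) ->
  m * (b - a) <= complex.Re (Cint g a b).
Proof. by move=> ab /Re_integrable gi gm; exact: Rintegral_ge. Qed.

Lemma Rintegral_id a b : a <= b ->
  \int[mu]_(t in `[a, b]) t = (b ^+ 2 - a ^+ 2) / 2.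
Proof.
rewrite le_eqVlt => /predU1P[->|ab].
  by rewrite set_itv1 Rintegral_set1 subrr mul0r.
pose F : R -> R := 2^-1 \*: (id * id).
have FE t : F t = t ^+ 2 / 2 by rewrite expr2 [RHS]mulrC.
have dF t : is_derive (t : R) (1 : R) F t.
  have h := is_deriveZ 2^-1 (is_deriveM (is_derive_id t (1:R)) (is_derive_id t (1:R))).
  apply: is_derive_eq h _; rewrite /GRing.scale /=.
  by field.
rewrite /Rintegral (@continuous_FTC2 _ id F) //=.
- by rewrite !FE; field.
- by apply: continuous_subspaceT => x; exact: cvg_id.
- have c t : {for t, continuous F}.
    by apply/differentiable_continuous/derivable1_diffP; have [] := dF t.
  split.
  + by move=> t _; have [] := dF t.
  + by apply: cvg_at_right_filter; exact: c.
  + by apply: cvg_at_left_filter; exact: c.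
- by move=> t _; rewrite derive1E; have [_ ->] := dF t.
Qed.

Lemma Cint_id a b : a <= b ->
  Cint (fun t => t%:C) a b = ((b ^+ 2 - a ^+ 2) / 2)%:C.
Proof. by move=> ab; rewrite /Cint /= Rintegral_id// Rintegral_cst// mul0r. Qed.

Lemma cont_cst (c : C) t : cont_at (fun=> c) t.
Proof. by move=> e e0; exists 1 => // s _; rewrite subrr rnorm0. Qed.

Lemma cont_real t : cont_at (fun t => t%:C) t.
Proof. by move=> e e0; exists e => // s; rewrite -raddfB rnorm_real. Qed.

Lemma contZ (c : C) g t : cont_at g t -> cont_at (fun t => c * g t) t.
Proof.
move=> gc e e0; have c0 : 0 < rnorm c + 1 by have := rnorm_ge0 c; lra.
have [d d0 hd] := gc (e / (rnorm c + 1)) (divr_gt0 e0 c0).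
exists d => // s /hd; rewrite -mulrBr rnormM ltr_pdivlMr// => h.
have := rnorm_ge0 (g s - g t); nra.
Qed.

End ComplexIntegral.

(** * Contour integrals over rectangles *)

Section RectangleIntegral.
Variable R : realType.
Local Notation C := (Cplx R).
Implicit Types (f g : C -> C) (x y r s : R).

Definition slope_at f (z a : C) := forall e : R, 0 < e ->
  exists2 d : R, 0 < d & forall w, rnorm (w - z) < d ->
    rnorm (f w - f z - a * (w - z)) <= e * rnorm (w - z).

(** Unlike the quotient of differences, this form of differentiability says
    something about [w = z], which is needed when [w] runs over a contour. *)
Lemma derivable_slope f (z : C) : derivable f z (1 : C) ->
  slope_at f z ('D_1 f z).
Proof.
move=> df e e0; rewrite /derive; move: df; rewrite /derivable.
set l := lim _ => df.
have Nl : nbhs l [set y | rnorm (y - l) < e] by apply/nbhs_rballP; exists e.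
have := df _ Nl; rewrite !near_simpl => /nbhs_rballP[d d0 hd].
exists d => // w wz; have [->|wz0] := eqVneq w z.
  by rewrite !subrr mulr0 subr0 rnorm0 mulr0.
have := hd (w - z); rewrite subr0 => /(_ wz); rewrite subr_eq0 => /(_ wz0) /=.
rewrite [_ *: 1]mulr1 subrK => h.
have -> : f w - f z - l * (w - z) = (w - z) * ((w - z)^-1 * (f w - f z) - l).
  by rewrite [RHS]mulrBr mulrA divff ?subr_eq0// mul1r [l * _]mulrC.
by rewrite rnormM mulrC ler_wpM2r ?rnorm_ge0// ltW.
Qed.

Lemma cont_horizontal f x y : {for (x +i* y : C), continuous f} ->
  cont_at (fun t => f (t +i* y)) x.
Proof.
move=> /continuous_rnormP fc e /fc[d d0 hd]; exists d => // s sx.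
apply: hd; rewrite (_ : _ - _ = (s - x)%:C) ?rnorm_real//.
by apply/eqP; rewrite eq_complex /= subrr !eqxx.
Qed.

Lemma cont_vertical f x y : {for (x +i* y : C), continuous f} ->
  cont_at (fun t => f (x +i* t)) y.
Proof.
move=> /continuous_rnormP fc e /fc[d d0 hd]; exists d => // s sx.
apply: hd; apply: le_lt_trans (rnorm_le_ReIm _) _.
by rewrite /= subrr normr0 add0r.
Qed.

Definition rect_int f x1 x2 y1 y2 : C :=
  Cint (fun t => f (t +i* y1)) x1 x2 - Cint (fun t => f (t +i* y2)) x1 x2 +
  'i * (Cint (fun t => f (x2 +i* t)) y1 y2 - Cint (fun t => f (x1 +i* t)) y1 y2).

Definition on_edge x1 x2 y1 y2 (P : C -> Prop) := forall x y,
  x1 <= x <= x2 -> y1 <= y <= y2 ->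
  [\/ x = x1, x = x2, y = y1 | y = y2] -> P (x +i* y).

Definition edge_cont f x1 x2 y1 y2 :=
  on_edge x1 x2 y1 y2 (fun z => {for z, continuous f}).

Section edges.
Variables (x1 x2 y1 y2 : R).
Hypotheses (x12 : x1 <= x2) (y12 : y1 <= y2).

Lemma edge_on (f : C -> C) : edge_cont f x1 x2 y1 y2 ->
  [/\ cont_on (fun t => f (t +i* y1)) x1 x2, cont_on (fun t => f (t +i* y2)) x1 x2,
      cont_on (fun t => f (x1 +i* t)) y1 y2 & cont_on (fun t => f (x2 +i* t)) y1 y2].
Proof.
move=> fc; split=> t tI.
- by apply: cont_horizontal; apply: fc => //; [rewrite lexx y12|constructor 3].
- by apply: cont_horizontal; apply: fc => //; [rewrite lexx y12|constructor 4].
- by apply: cont_vertical; apply: fc => //; [rewrite lexx x12|constructor 1].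
- by apply: cont_vertical; apply: fc => //; [rewrite lexx x12|constructor 2].
Qed.

Lemma rect_intD f g : edge_cont f x1 x2 y1 y2 -> edge_cont g x1 x2 y1 y2 ->
  rect_int (fun z => f z + g z) x1 x2 y1 y2 =
  rect_int f x1 x2 y1 y2 + rect_int g x1 x2 y1 y2.
Proof.
move=> /edge_on[f1 f2 f3 f4] /edge_on[g1 g2 g3 g4].
by rewrite /rect_int !CintD//; ring.
Qed.

Lemma rect_intZ (c : C) f : edge_cont f x1 x2 y1 y2 ->
  rect_int (fun z => c * f z) x1 x2 y1 y2 = c * rect_int f x1 x2 y1 y2.
Proof. by move=> /edge_on[f1 f2 f3 f4]; rewrite /rect_int !CintZ//; ring. Qed.

Lemma rect_int_bound f (M : R) : edge_cont f x1 x2 y1 y2 ->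
  on_edge x1 x2 y1 y2 (fun z => rnorm (f z) <= M) ->
  rnorm (rect_int f x1 x2 y1 y2) <= 4 * M * ((x2 - x1) + (y2 - y1)).
Proof.
move=> /edge_on[f1 f2 f3 f4] fM; rewrite /rect_int.
have b1 : rnorm (Cint (fun t => f (t +i* y1)) x1 x2) <= 2 * M * (x2 - x1).
  by apply: Cint_bound => // t tI; apply: fM => //; [rewrite lexx y12|constructor 3].
have b2 : rnorm (Cint (fun t => f (t +i* y2)) x1 x2) <= 2 * M * (x2 - x1).
  by apply: Cint_bound => // t tI; apply: fM => //; [rewrite lexx y12|constructor 4].
have b3 : rnorm (Cint (fun t => f (x1 +i* t)) y1 y2) <= 2 * M * (y2 - y1).
  by apply: Cint_bound => // t tI; apply: fM => //; [rewrite lexx x12|constructor 1].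
have b4 : rnorm (Cint (fun t => f (x2 +i* t)) y1 y2) <= 2 * M * (y2 - y1).
  by apply: Cint_bound => // t tI; apply: fM => //; [rewrite lexx x12|constructor 2].
apply: le_trans (rnormD _ _) _; rewrite rnormM rnorm_i mul1r.
apply: le_trans (lerD (rnormB _ _) (rnormB _ _)) _.
lra.
Qed.

Lemma eq_rect_int f g : on_edge x1 x2 y1 y2 (fun z => f z = g z) ->
  rect_int f x1 x2 y1 y2 = rect_int g x1 x2 y1 y2.
Proof.
move=> fg; rewrite /rect_int; congr (_ - _ + 'i * (_ - _)); apply: eq_Cint => t tI.
- by apply: fg => //; [rewrite lexx y12|constructor 3].
- by apply: fg => //; [rewrite lexx y12|constructor 4].
- by apply: fg => //; [rewrite lexx x12|constructor 2].
- by apply: fg => //; [rewrite lexx x12|constructor 1].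
Qed.

Lemma rect_int_affine (a b : C) :
  rect_int (fun z => a + b * z) x1 x2 y1 y2 = 0.
Proof.
have H (c d : C) p q : p <= q ->
    Cint (fun t => c + d * t%:C) p q =
    (q - p)%:C * c + d * ((q ^+ 2 - p ^+ 2) / 2)%:C.
  move=> pq; rewrite CintD; last 2 first.
  - by move=> t _; exact: cont_cst.
  - by move=> t _; apply: contZ; exact: cont_real.
  by rewrite Cint_cst// CintZ ?Cint_id// => t _; exact: cont_real.
have e1 y : Cint (fun t => a + b * (t +i* y)) x1 x2 =
    (x2 - x1)%:C * (a + b * (0 +i* y)) + b * ((x2 ^+ 2 - x1 ^+ 2) / 2)%:C.
  rewrite -H//; congr Cint; apply/funext => t.
  rewrite -addrA -mulrDr; congr (_ + _ * _).
  by apply/eqP; rewrite eq_complex /= add0r addr0 !eqxx.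
have e2 x : Cint (fun t => a + b * (x +i* t)) y1 y2 =
    (y2 - y1)%:C * (a + b * x%:C) + b * 'i * ((y2 ^+ 2 - y1 ^+ 2) / 2)%:C.
  rewrite -H//; congr Cint; apply/funext => t.
  rewrite -addrA -mulrA -mulrDr; congr (_ + _ * _).
  by apply/eqP; rewrite eq_complex /= !(mul0r,mul1r,add0r,addr0,subr0,mulr0) !eqxx.
rewrite /rect_int !e1 !e2 {e1 e2}; case: a => a1 a2; case: b => b1 b2.
by apply/eqP; rewrite eq_complex /=; apply/andP; split; apply/eqP; field.
Qed.

End edges.

(** The integrals over the common vertical side cancel, so only
    the horizontal sides have to be split; [f] may be singular inside. *)
Lemma rect_int_splitx f x1 xm x2 y1 y2 : x1 <= xm <= x2 ->
  (forall x, x1 <= x <= x2 -> {for (x +i* y1 : C), continuous f}) ->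
  (forall x, x1 <= x <= x2 -> {for (x +i* y2 : C), continuous f}) ->
  rect_int f x1 x2 y1 y2 = rect_int f x1 xm y1 y2 + rect_int f xm x2 y1 y2.
Proof.
move=> xI c1 c2; rewrite /rect_int.
rewrite (@Cint_split _ (fun t => f (t +i* y1)) x1 xm x2)//; last first.
  by move=> t /c1 /cont_horizontal.
rewrite (@Cint_split _ (fun t => f (t +i* y2)) x1 xm x2)//; last first.
  by move=> t /c2 /cont_horizontal.
ring.
Qed.

Lemma rect_int_splity f x1 x2 y1 ym y2 : y1 <= ym <= y2 ->
  (forall y, y1 <= y <= y2 -> {for (x1 +i* y : C), continuous f}) ->
  (forall y, y1 <= y <= y2 -> {for (x2 +i* y : C), continuous f}) ->
  rect_int f x1 x2 y1 y2 = rect_int f x1 x2 y1 ym + rect_int f x1 x2 ym y2.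
Proof.
move=> yI c1 c2; rewrite /rect_int.
rewrite (@Cint_split _ (fun t => f (x1 +i* t)) y1 ym y2)//; last first.
  by move=> t /c1 /cont_vertical.
rewrite (@Cint_split _ (fun t => f (x2 +i* t)) y1 ym y2)//; last first.
  by move=> t /c2 /cont_vertical.
ring.
Qed.

End RectangleIntegral.

(** * Goursat's theorem *)

Section GoursatTheorem.
Variable R : realType.
Local Notation C := (Cplx R).
Implicit Types (f g : C -> C) (x y r s : R).

Lemma derivable_cont f (z : C) : derivable f z (1 : C) -> {for z, continuous f}.
Proof. by move=> /derivable1_diffP; exact: differentiable_continuous. Qed.

Definition derivable_on (D : set C) f := forall z, D z -> derivable f z (1 : C).

Definition rect x1 x2 y1 y2 : set C :=
  [set z | x1 <= complex.Re z <= x2 /\ y1 <= complex.Im z <= y2].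

Lemma derivable_edge f x1 x2 y1 y2 :
  on_edge x1 x2 y1 y2 (fun z => derivable f z (1 : C)) -> edge_cont f x1 x2 y1 y2.
Proof. by move=> df x y xI yI xy; apply: derivable_cont; exact: df. Qed.

Lemma quarter_pigeonhole (e a b c d ab cd s : R) :
  s <= ab + cd -> ab <= a + b -> cd <= c + d ->
  a < e / 4 -> b < e / 4 -> c < e / 4 -> d < e / 4 -> e <= s -> False.
Proof. lra. Qed.

(** One step of the subdivision: the integral is the sum of the integrals over
    the four quarters, one of which carries at least a quarter of it. *)
Lemma goursat_step f (x y w h e : R) : 0 <= w -> 0 <= h ->
  derivable_on (rect x (x + w) y (y + h)) f ->
  e <= rnorm (rect_int f x (x + w) y (y + h)) ->
  exists x' y', [/\ x' = x \/ x' = x + w / 2, y' = y \/ y' = y + h / 2 &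
    e / 4 <= rnorm (rect_int f x' (x' + w / 2) y' (y' + h / 2))].
Proof.
move=> w0 h0 df ef.
have cf u v : x <= u <= x + w -> y <= v <= y + h -> {for (u +i* v : C), continuous f}.
  by move=> uI vI; apply: derivable_cont; apply: df.
have ew : x + w = x + w / 2 + w / 2 by field.
have eh : y + h = y + h / 2 + h / 2 by field.
have xm : x <= x + w / 2 <= x + w by apply/andP; split; lra.
have ym : y <= y + h / 2 <= y + h by apply/andP; split; lra.
have xx : x <= x <= x + w by apply/andP; split; lra.
have yy : y <= y <= y + h by apply/andP; split; lra.
have xw : x <= x + w <= x + w by apply/andP; split; lra.
have yh : y <= y + h <= y + h by apply/andP; split; lra.
have := ef; rewrite (@rect_int_splitx _ f x (x + w / 2))//; last 2 first.
- by move=> u uI; apply: cf.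
- by move=> u uI; apply: cf.
rewrite (@rect_int_splity _ f x (x + w / 2) y (y + h / 2))//; last 2 first.
- by move=> u uI; apply: cf.
- by move=> u uI; apply: cf.
rewrite (@rect_int_splity _ f (x + w / 2) (x + w) y (y + h / 2))//; last 2 first.
- by move=> u uI; apply: cf.
- by move=> u uI; apply: cf.
rewrite ew eh.
set A := rect_int _ _ _ _ _; set B := rect_int _ _ _ _ _.
set D := rect_int _ _ _ _ _; set E := rect_int _ _ _ _ _ => big.
have [hA|hA] := leP (e / 4) (rnorm A); first by exists x, y; split; [left|left|].
have [hB|hB] := leP (e / 4) (rnorm B); first by exists x, (y + h / 2); split; [left|right|].
have [hD|hD] := leP (e / 4) (rnorm D); first by exists (x + w / 2), y; split; [right|left|].
have [hE|hE] := leP (e / 4) (rnorm E); first by exists (x + w / 2), (y + h / 2); split; [right|right|].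
move: (rnormD (A + B) (D + E)) (rnormD A B) (rnormD D E) hA hB hD hE big.
move=> p1 p2 p3 p4 p5 p6 p7 p8; exfalso. exact: (quarter_pigeonhole p1 p2 p3 p4 p5 p6 p7 p8).
Qed.

Lemma affine_cont (b a v : C) : {for v, continuous (fun v : C => b + a * v)}.
Proof.
have h1 : {for v, continuous (fun=> b : C)} by exact: cst_continuous.
have h2 : {for v, continuous (fun=> a : C)} by exact: cst_continuous.
have h3 : {for v, continuous (fun v => v : C)} by move=> A; exact.
exact: (continuousD h1 (continuousM h2 h3)).
Qed.

(** Near a point of differentiability [f] differs from an affine function by
    little, and affine functions have vanishing contour integrals. *)
Lemma rect_int_local f (x y w h L eta : R) (z a : C) : 0 <= w -> 0 <= h ->
  0 <= L ->
  edge_cont f x (x + w) y (y + h) ->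
  on_edge x (x + w) y (y + h) (fun v => rnorm (v - z) <= L /\
     rnorm (f v - f z - a * (v - z)) <= eta * rnorm (v - z)) -> 0 <= eta ->
  rnorm (rect_int f x (x + w) y (y + h)) <= 4 * (eta * L) * (w + h).
Proof.
move=> w0 h0 L0 fc fL eta0.
have xw : x <= x + w by lra.
have yh : y <= y + h by lra.
have ac : edge_cont (fun v => (a * z - f z) + - a * v) x (x + w) y (y + h).
  by move=> u v _ _ _; exact: affine_cont.
have -> : rect_int f x (x + w) y (y + h) =
    rect_int (fun v => f v + ((a * z - f z) + - a * v)) x (x + w) y (y + h).
  by rewrite rect_intD// rect_int_affine// addr0.
have -> : w + h = x + w - x + (y + h - y) by ring.
apply: (rect_int_bound xw yh).
  by move=> u v uI vI uv; exact: (continuousD (fc u v uI vI uv) (ac u v uI vI uv)).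
move=> u v uI vI uv; have [h1 h2] := fL u v uI vI uv.
have -> : f (u +i* v) + (a * z - f z + - a * (u +i* v)) =
  f (u +i* v) - f z - a * ((u +i* v) - z) by ring.
apply: le_trans h2 _; exact: ler_wpM2l.
Qed.

(** Repeated subdivision yields rectangles with sides proportional to [2 ^- n]
    whose contour integrals are at least [e / 4 ^ n], and which shrink to a
    point [z].  By [rect_int_local] at [z] these integrals are [o(4 ^- n)]. *)
Theorem goursat f x1 x2 y1 y2 : x1 <= x2 -> y1 <= y2 ->
  derivable_on (rect x1 x2 y1 y2) f -> rect_int f x1 x2 y1 y2 = 0.
Proof.
move=> x12 y12 df; apply: rnorm_eq0; apply/eqP; rewrite eq_le rnorm_ge0 andbT.
rewrite leNgt; apply/negP.
pose w := x2 - x1; pose h := y2 - y1; set e := rnorm _ => e0.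
have w0 : 0 <= w by rewrite /w; lra.
have h0 : 0 <= h by rewrite /h; lra.
pose q n : R := 2^-1 ^+ n.
have q0 n : 0 <= q n by rewrite exprn_ge0// invr_ge0.
have qS n : q n.+1 = q n / 2 by rewrite /q exprS mulrC.
pose good n (p : R * R) := [/\ x1 <= p.1 /\ p.1 + w * q n <= x2,
  y1 <= p.2 /\ p.2 + h * q n <= y2 &
  e * q n ^+ 2 <= rnorm (rect_int f p.1 (p.1 + w * q n) p.2 (p.2 + h * q n))].
have step : forall np : nat * (R * R), exists p', good np.1 np.2 ->
   [/\ good np.1.+1 p', 0 <= p'.1 - np.2.1 <= w * q np.1 / 2 &
       0 <= p'.2 - np.2.2 <= h * q np.1 / 2].
  move=> [n [x y]] /=; have [g|] := pselect (good n (x, y)); last by exists (0, 0).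
  have [/= [gx1 gx2] [gy1 gy2] ge] := g.
  have wq : 0 <= w * q n by rewrite mulr_ge0.
  have hq : 0 <= h * q n by rewrite mulr_ge0.
  have [|x' [y' [hx hy he]]] := goursat_step wq hq _ ge.
    by move=> z [zx zy]; apply: df; split; apply/andP; split; lra.
  exists (x', y') => _; rewrite /good /= qS !mulrA; split.
  - split.
    + by split; case: hx => ->; clear - gx1 gx2 wq; lra.
    + by split; case: hy => ->; clear - gy1 gy2 hq; lra.
    + apply: le_trans he; rewrite le_eqVlt; apply/orP; left; apply/eqP; by field.
  - by apply/andP; case: hx => ->; split; clear - wq; lra.
  - by apply/andP; case: hy => ->; split; clear - hq; lra.
have [F HF] := choice step.
pose fix p n := if n is m.+1 then F (m, p m) else (x1, y1).
have gp n : good n (p n).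
  elim: n => [|n IH]; last by have [] := HF (n, p n) IH.
  by rewrite /good /q /= expr1n expr0 !mulr1 /w /h !subrKC !lexx.
have [l1 hl1] : exists l, forall n, `|(p n).1 - l| <= 2 * (w / 2) * q n.
  apply: geom_complete_real => n.
  have [_ /andP[a1 a2] _] := HF (n, p n) (gp n).
  by rewrite ger0_norm// (le_trans a2)// mulrAC.
have [l2 hl2] : exists l, forall n, `|(p n).2 - l| <= 2 * (h / 2) * q n.
  apply: geom_complete_real => n.
  have [_ _ /andP[a1 a2]] := HF (n, p n) (gp n).
  by rewrite ger0_norm// (le_trans a2)// mulrAC.
have ew : 2 * (w / 2) = w by field.
have eh : 2 * (h / 2) = h by field.
rewrite ew in hl1; rewrite eh in hl2.
have zR : rect x1 x2 y1 y2 (l1 +i* l2).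
  have gb n : [/\ l1 - x2 <= 0 + w * q n, x1 - l1 <= 0 + w * q n,
               l2 - y2 <= 0 + h * q n & y1 - l2 <= 0 + h * q n].
    have [[a1 a2] [a3 a4] _] := gp n.
    have := hl1 n; have := hl2 n; rewrite !ler_norml => /andP[b1 b2] /andP[b3 b4].
    have := mulr_ge0 w0 (q0 n); have := mulr_ge0 h0 (q0 n).
    by split; lra.
  split => /=; apply/andP; split; rewrite -subr_le0.
  - by apply: (@le_geom _ w) => n; have [] := gb n.
  - by apply: (@le_geom _ w) => n; have [] := gb n.
  - by apply: (@le_geom _ h) => n; have [] := gb n.
  - by apply: (@le_geom _ h) => n; have [] := gb n.
have sl := derivable_slope (df _ zR).
set z : C := l1 +i* l2 in zR sl; set a := 'D_1 f z in sl.
pose M := w + h + 1.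
have M0 : 0 < M by rewrite /M; lra.
(* [eta] makes the local bound [4 * eta * (2 * M * q n) * (w + h) * q n] less
   than [e * q n ^+ 2]. *)
pose eta := e / (16 * M ^+ 2).
have eta0 : 0 < eta by rewrite divr_gt0// mulr_gt0// exprn_gt0.
have [d d0 hd] := sl eta eta0.
have [n hn] := geom_lt (2 * M) d0.
have [[a1 a2] [a3 a4] a5] := gp n.
have wq : 0 <= w * q n by rewrite mulr_ge0.
have hq : 0 <= h * q n by rewrite mulr_ge0.
have L0 : 0 <= 2 * M * q n by rewrite mulr_ge0// mulr_ge0// ltW.
have near_z u v : (p n).1 <= u <= (p n).1 + w * q n ->
    (p n).2 <= v <= (p n).2 + h * q n -> rnorm ((u +i* v) - z) <= 2 * M * q n.
  move=> /andP[u1 u2] /andP[v1 v2].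
  apply: le_trans (rnorm_le_ReIm _) _ => /=.
  have := hl1 n; have := hl2 n; rewrite !ler_norml => /andP[b1 b2] /andP[b3 b4].
  have c1 : `|u - l1| <= 2 * w * q n.
    by rewrite ler_norml; apply/andP; split; clear - wq b3 b4 u1 u2; lra.
  have c2 : `|v - l2| <= 2 * h * q n.
    by rewrite ler_norml; apply/andP; split; clear - hq b1 b2 v1 v2; lra.
  by rewrite /M; have := q0 n; lra.
have dp u v : (p n).1 <= u <= (p n).1 + w * q n ->
    (p n).2 <= v <= (p n).2 + h * q n -> derivable f (u +i* v) (1 : C).
  move=> /andP[u1 u2] /andP[v1 v2]; apply: df.
  by split; apply/andP; split => /=; clear - a1 a2 a3 a4 u1 u2 v1 v2; lra.
have Hl : rnorm (rect_int f (p n).1 ((p n).1 + w * q n) (p n).2 ((p n).2 + h * q n))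
    <= 4 * (eta * (2 * M * q n)) * (w * q n + h * q n).
  apply: (@rect_int_local f _ _ _ _ _ eta z a wq hq L0 _ _ (ltW eta0)).
    by apply: derivable_edge => u v uI vI _; exact: dp.

  move=> u v uI vI _; split; first exact: near_z.
  by apply: hd; apply: le_lt_trans (near_z _ _ uI vI) hn.
move: (le_trans a5 Hl).
have qp : 0 < q n by rewrite exprn_gt0// invr_gt0.
have -> : 4 * (eta * (2 * M * q n)) * (w * q n + h * q n) =
   e * q n ^+ 2 * ((w + h) / (2 * M)).
  by rewrite /eta; field; rewrite gt_eqF.
rewrite -[leLHS]mulr1 ler_pM2l; last by rewrite mulr_gt0// exprn_gt0.
by rewrite ler_pdivlMr ?mulr_gt0// mul1r /M; lra.
Qed.

End GoursatTheorem.

(** * Cauchy's formula on squares *)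

Section Cauchy.
Variable R : realType.
Local Notation C := (Cplx R).
Implicit Types (f g : C -> C) (x y r s : R).

(** The frame between the two rectangles is cut into a left strip, a right
    strip and two pieces below and above the inner rectangle. *)
Lemma rect_int_frame f x1 a b x2 y1 c d y2 :
  x1 <= a -> a < b -> b <= x2 -> y1 <= c -> c < d -> d <= y2 ->
  (forall x y, x1 <= x <= x2 -> y1 <= y <= y2 ->
     [\/ x <= a, b <= x, y <= c | d <= y] -> derivable f (x +i* y : C) (1 : C)) ->
  rect_int f x1 x2 y1 y2 = rect_int f a b c d.
Proof.
move=> x1a ab bx2 y1c cd dy2 df.
have cf x y : x1 <= x <= x2 -> y1 <= y <= y2 ->
     [\/ x <= a, b <= x, y <= c | d <= y] -> {for (x +i* y : C), continuous f}.
  by move=> *; apply: derivable_cont; apply: df.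
have y12 : y1 <= y2 by lra.
have ax2 : a <= x2 by lra.
have cy2 : c <= y2 by lra.
rewrite (@rect_int_splitx _ f x1 a x2); last 3 first.
- by rewrite x1a; lra.
- by move=> x xI; apply: cf => //; [rewrite lexx|constructor 3].
- by move=> x xI; apply: cf => //; [rewrite lexx andbT|constructor 4].
rewrite (@goursat _ f x1 a)//; last first.
  case=> x y [/= /andP[h1 h2] yI]; apply: df => //; last by constructor 1.
  by rewrite h1; lra.
rewrite add0r (@rect_int_splitx _ f a b x2); last 3 first.
- by rewrite bx2 ltW.
- move=> x /andP[h1 h2]; apply: cf; [by rewrite h2; lra|by rewrite lexx|by constructor 3].
- move=> x /andP[h1 h2]; apply: cf; [by rewrite h2; lra|by rewrite lexx andbT|by constructor 4].
rewrite (@goursat _ f b x2)//; last first.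
  case=> x y [/= /andP[h1 h2] yI]; apply: df => //; last by constructor 2.
  by rewrite h2; lra.
rewrite addr0 (@rect_int_splity _ f a b y1 c y2); last 3 first.
- by rewrite y1c; lra.
- by move=> y yI; apply: cf => //; [rewrite x1a|constructor 1].
- by move=> y yI; apply: cf => //; [rewrite bx2 andbT; lra|constructor 2].
rewrite (@goursat _ f a b y1 c)// ?ltW//; last first.
  case=> x y [/= /andP[h1 h2] /andP[h3 h4]]; apply: df => //; last by constructor 3.
    by apply/andP; split; lra.
  by rewrite h3; lra.
rewrite add0r (@rect_int_splity _ f a b c d y2); last 3 first.
- by rewrite dy2 ltW.
- move=> y /andP[h1 h2]; apply: cf; [by rewrite x1a|by rewrite h2; lra|by constructor 1].
- move=> y /andP[h1 h2]; apply: cf; [by rewrite bx2 andbT; lra|by rewrite h2; lra|by constructor 2].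
rewrite (@goursat _ f a b d y2)// ?ltW//; last first.
  case=> x y [/= /andP[h1 h2] /andP[h3 h4]]; apply: df => //; last by constructor 4.
    by apply/andP; split; lra.
  by rewrite h4; lra.
by rewrite addr0.
Qed.

Lemma derivable_subVf z0 (z : C) : z != z0 ->
  derivable (fun w : C => (w - z0)^-1) z (1 : C).
Proof.
move=> zz; apply: (@derivableV C C (fun w : C => w - z0)); first by rewrite subr_eq0.
by apply: derivableB => //; exact: derivable_cst.
Qed.

Lemma pt_neq x y p q : [\/ x < p, p < x, y < q | q < y] -> (x +i* y : C) != p +i* q.
Proof.
move=> h; rewrite eq_complex /=; apply/negP => /andP[/eqP xp /eqP yq].
by move: h; rewrite xp yq; case; rewrite ltxx.
Qed.

(** The integral of [1 / (w - z0)], that is [2 * pi * i] for [z0] inside the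
    square.  It enters Cauchy's formula as a factor which is bounded away from
    [0] ([wind_ge4]) and independent of [z0] ([wind_const]). *)
Definition wind (r : R) (z0 : C) : C :=
  rect_int (fun w => (w - z0)^-1) (- r) r (- r) r.

Section square.
Variables (r : R) (p q : R).
Hypotheses (pr : `|p| < r) (qr : `|q| < r).
Local Notation z0 := (p +i* q : C).

Let pr1 : - r < p. Proof. by move: pr; rewrite ltr_norml => /andP[]. Qed.
Let pr2 : p < r. Proof. by move: pr; rewrite ltr_norml => /andP[]. Qed.
Let qr1 : - r < q. Proof. by move: qr; rewrite ltr_norml => /andP[]. Qed.
Let qr2 : q < r. Proof. by move: qr; rewrite ltr_norml => /andP[]. Qed.

Lemma small_square : exists2 s0 : R, 0 < s0 & forall s, 0 < s <= s0 ->
  [/\ - r <= p - s, p + s <= r, - r <= q - s & q + s <= r].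
Proof.
exists (Num.min (Num.min (p + r) (r - p)) (Num.min (q + r) (r - q))).
  by move: pr1 pr2 qr1 qr2 => *; rewrite !lt_min; do ![apply/andP; split]; lra.
move=> s /andP[s0]; rewrite !le_min => /andP[/andP[h1 h2] /andP[h3 h4]].
by split; lra.
Qed.

Lemma rect_int_shrink f s : 0 < s ->
  - r <= p - s -> p + s <= r -> - r <= q - s -> q + s <= r ->
  (forall z, rect (- r) r (- r) r z -> z != z0 -> derivable f z (1 : C)) ->
  rect_int f (- r) r (- r) r = rect_int f (p - s) (p + s) (q - s) (q + s).
Proof.
move=> s0 h1 h2 h3 h4 df; apply: rect_int_frame => //; try lra.
move=> x y xI yI xy; apply: df => //; apply: pt_neq.
by case: xy => h; [constructor 1|constructor 2|constructor 3|constructor 4]; lra.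
Qed.

Lemma edge_dist s x y : 0 <= s ->
  [\/ x = p - s, x = p + s, y = q - s | y = q + s] -> s <= rnorm ((x +i* y) - z0).
Proof.
move=> s0 h; case: h => ->.
- by apply: le_trans (Re_le_rnorm _); rewrite /= addrAC subrr add0r normrN ger0_norm.
- by apply: le_trans (Re_le_rnorm _); rewrite /= addrAC subrr add0r ger0_norm.
- by apply: le_trans (Im_le_rnorm _); rewrite /= addrAC subrr add0r normrN ger0_norm.
- by apply: le_trans (Im_le_rnorm _); rewrite /= addrAC subrr add0r ger0_norm.
Qed.

(** On a square centred at [z0] each of the four sides contributes at least
    [1] to the imaginary part of the integral. *)
Lemma inv_small_square s : 0 < s ->
  4 <= complex.Im (rect_int (fun w => (w - z0)^-1) (p - s) (p + s) (q - s) (q + s)).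
Proof.
move=> s0; have xx : p - s <= p + s by lra.
have yy : q - s <= q + s by lra.
have ec : edge_cont (fun w => (w - z0)^-1) (p - s) (p + s) (q - s) (q + s).
  apply: derivable_edge => x y _ _ xy; apply: derivable_subVf.
  have := edge_dist (ltW s0) xy => h; apply/eqP => e; move: h.
  by rewrite e subrr rnorm0; lra.
have [c1 c2 c3 c4] := edge_on xx yy ec.
have key u : `|u| <= s -> (2 * s)^-1 <= s / (u ^+ 2 + s ^+ 2).
  move=> us; have us2 : u ^+ 2 <= s ^+ 2.
    by move: us; rewrite ler_norml => /andP[? ?]; nra.
  have ss : 0 < s ^+ 2 by rewrite exprn_gt0.
  have us0 : 0 <= u ^+ 2 by exact: sqr_ge0.
  rewrite ler_pdivlMr; last by lra.
  rewrite mulrC ler_pdivrMr; last by lra.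
  rewrite mulrCA -expr2; lra.
rewrite /rect_int.
have b1 : 1 <= complex.Im (Cint (fun t => ((t +i* (q - s)) - z0)^-1) (p - s) (p + s)).
  apply: le_trans (Im_Cint_ge xx c1 (m := (2 * s)^-1) _).
    rewrite (_ : p + s - (p - s) = 2 * s); last by ring.
    by rewrite mulVf// gt_eqF//; lra.
  move=> t /andP[t1 t2] /=; rewrite (_ : q - s - q = - s); last by ring.
  rewrite sqrrN mulNr opprK; apply: key; rewrite ler_norml; apply/andP; split; lra.
have b2 : 1 <= complex.Im (- Cint (fun t => ((t +i* (q + s)) - z0)^-1) (p - s) (p + s)).
  have c2' : cont_on (fun t => - 1 * ((t +i* (q + s)) - z0)^-1) (p - s) (p + s).
    by move=> t /c2; apply: contZ.
  rewrite -mulN1r -CintZ//.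
  apply: le_trans (Im_Cint_ge xx c2' (m := (2 * s)^-1) _).
    rewrite (_ : p + s - (p - s) = 2 * s); last by ring.
    by rewrite mulVf// gt_eqF//; lra.
  move=> t /andP[t1 t2]; rewrite mulN1r /= (_ : q + s - q = s); last by ring.
  rewrite opprK; apply: key; rewrite ler_norml; apply/andP; split; lra.
have b3 : 1 <= complex.Re (Cint (fun t => (((p + s) +i* t) - z0)^-1) (q - s) (q + s)).
  apply: le_trans (Re_Cint_ge yy c4 (m := (2 * s)^-1) _).
    rewrite (_ : q + s - (q - s) = 2 * s); last by ring.
    by rewrite mulVf// gt_eqF//; lra.
  move=> t /andP[t1 t2] /=; rewrite (_ : p + s - p = s); last by ring.
  rewrite addrC; apply: key; rewrite ler_norml; apply/andP; split; lra.
have b4 : 1 <= complex.Re (- Cint (fun t => (((p - s) +i* t) - z0)^-1) (q - s) (q + s)).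
  have c3' : cont_on (fun t => - 1 * (((p - s) +i* t) - z0)^-1) (q - s) (q + s).
    by move=> t /c3; apply: contZ.
  rewrite -mulN1r -CintZ//.
  apply: le_trans (Re_Cint_ge yy c3' (m := (2 * s)^-1) _).
    rewrite (_ : q + s - (q - s) = 2 * s); last by ring.
    by rewrite mulVf// gt_eqF//; lra.
  move=> t /andP[t1 t2]; rewrite mulN1r /= (_ : p - s - p = - s); last by ring.
  rewrite sqrrN mulNr opprK addrC; apply: key; rewrite ler_norml; apply/andP; split; lra.
move: b1 b2 b3 b4.
set A := Cint _ _ _; set B := Cint _ _ _; set D := Cint _ _ _; set E := Cint _ _ _.
case: A B D E => [a1 a2] [b1 b2] [d1 d2] [e1 e2] /= u1 u2 u3 u4; lra.
Qed.

Lemma wind_ge4 : 4 <= rnorm (wind r z0).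
Proof.
have [s0 s00 hs] := small_square.
have [|h1 h2 h3 h4] := hs s0; first by rewrite s00 lexx.
rewrite /wind (rect_int_shrink s00)//; last by move=> z _; exact: derivable_subVf.
apply: le_trans (Im_le_rnorm _); apply: le_trans (ler_norm _).
exact: inv_small_square.
Qed.

(** The quotient of differences of [g] at [z0] is bounded near [z0] and
    differentiable elsewhere, so its contour integral equals that over
    arbitrarily small squares around [z0] and hence vanishes. *)
Lemma cauchy_formula g : derivable_on (rect (- r) r (- r) r) g ->
  g z0 * wind r z0 = rect_int (fun w => g w * (w - z0)^-1) (- r) r (- r) r.
Proof.
move=> dg; pose f w := (w - z0)^-1 * (g w - g z0).
have rr : - r <= r by have := ltW pr1; have := ltW pr2; lra.
have z0R : rect (- r) r (- r) r z0 by split; apply/andP; split; apply/ltW.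
have df z : rect (- r) r (- r) r z -> z != z0 -> derivable f z (1 : C).
  move=> /dg dz zz; apply: derivableM; first exact: derivable_subVf.
  exact: (derivableB dz (derivable_cst (g z0) z 1)).
have edge_neq x y : [\/ x = - r, x = r, y = - r | y = r] -> (x +i* y : C) != z0.
  by move=> h; apply: pt_neq; case: h => ->; [constructor 1|constructor 2|constructor 3|constructor 4].
have sl := derivable_slope (dg _ z0R); set a := 'D_1 g _ in sl.
have [d d0 hd] := sl 1 ltr01.
have f0 : rect_int f (- r) r (- r) r = 0.
  apply: rnorm_eq0; apply/eqP; rewrite eq_le rnorm_ge0 andbT.
  apply/ler_addgt0Pr => e e0; rewrite add0r.
  have [s0 s00 hs] := small_square.
  pose M := rnorm a + 1.
  have M0 : 0 < M by have := rnorm_ge0 a; rewrite /M; lra.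
  pose s := Num.min s0 (Num.min (d / 3) (e / (16 * M))).
  have s_gt0 : 0 < s.
    by rewrite !lt_min s00 !divr_gt0// mulr_gt0.
  have [ss0 sd se] : [/\ s <= s0, s <= d / 3 & s <= e / (16 * M)].
    by split; rewrite /s !ge_min lexx ?orbT.
  have [|h1 h2 h3 h4] := hs s; first by rewrite s_gt0 ss0.
  rewrite (rect_int_shrink s_gt0 h1 h2 h3 h4 df).
  have xx : p - s <= p + s by lra.
  have yy : q - s <= q + s by lra.
  apply: le_trans (rect_int_bound xx yy (M := M) _ _) _.
  - apply: derivable_edge => x y /andP[x1 x2] /andP[y1 y2] xy; apply: df.
      by split; apply/andP; split => /=; lra.
    have := edge_dist (ltW s_gt0) xy => h; apply/eqP => ez; move: h.
    by rewrite ez subrr rnorm0; lra.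
  - move=> x y /andP[x1 x2] /andP[y1 y2] xy.
    have dist := edge_dist (ltW s_gt0) xy.
    set w : C := x +i* y.
    have wz : rnorm (w - z0) <= 2 * s.
      apply: le_trans (rnorm_le_ReIm _) _ => /=.
      have : `|x - p| <= s by rewrite ler_norml; apply/andP; split; lra.
      have : `|y - q| <= s by rewrite ler_norml; apply/andP; split; lra.
      lra.
    have slw : rnorm (g w - g z0 - a * (w - z0)) <= rnorm (w - z0).
      by rewrite -[leRHS]mul1r; apply: hd; lra.
    have wp : 0 < rnorm (w - z0) by apply: lt_le_trans dist.
    rewrite /f rnormM rnormV mulrC ler_pdivrMr//.
    have -> : g w - g z0 = (g w - g z0 - a * (w - z0)) + a * (w - z0) by ring.
    apply: le_trans (rnormD _ _) _; rewrite rnormM /M mulrDl mul1r addrC.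
    by rewrite lerD2l.
  rewrite (_ : p + s - (p - s) + (q + s - (q - s)) = 4 * s); last by ring.
  rewrite ler_pdivlMr in se; last by rewrite mulr_gt0.
  lra.
have ec1 : edge_cont (fun w => g w * (w - z0)^-1) (- r) r (- r) r.
  apply: derivable_edge => x y xI yI xy; apply: derivableM; first exact: dg.
  by apply: derivable_subVf; exact: edge_neq.
have ec2 : edge_cont (fun w => (w - z0)^-1) (- r) r (- r) r.
  apply: derivable_edge => x y xI yI xy.
  by apply: derivable_subVf; exact: edge_neq.
have ec3 : edge_cont f (- r) r (- r) r.
  by apply: derivable_edge => x y xI yI xy; apply: df => //; exact: edge_neq.
have -> : (fun w => g w * (w - z0)^-1) = (fun w => f w + g z0 * (w - z0)^-1).
  by apply/funext => w; rewrite /f; ring.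
have ec4 : edge_cont (fun w => g z0 * (w - z0)^-1) (- r) r (- r) r.
  by move=> x y xI yI xy; apply: continuousM; [exact: cst_continuous|exact: ec2].
by rewrite rect_intD// f0 add0r rect_intZ.
Qed.

End square.

End Cauchy.

(** * A second-order Taylor bound *)

Section Taylor.
Variable R : realType.
Local Notation C := (Cplx R).
Implicit Types (f g : C -> C) (x y r s : R).

Lemma edge_norm r x y : 0 <= r -> [\/ x = - r, x = r, y = - r | y = r] ->
  r <= rnorm (x +i* y : C).
Proof.
move=> r0 h; have := @edge_dist R 0 0 r x y r0; rewrite !sub0r !add0r => /(_ h).
by rewrite (_ : (x +i* y : C) - (0 +i* 0 : C) = x +i* y) // subr0.
Qed.

Lemma rnorm_lt_coord r (z : C) : rnorm z < r ->
  `|complex.Re z| < r /\ `|complex.Im z| < r.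
Proof.
by move=> zr; split; apply: le_lt_trans zr; [exact: Re_le_rnorm|exact: Im_le_rnorm].
Qed.

Lemma dist_lower r (w z : C) : r <= rnorm w -> r - rnorm z <= rnorm (w - z).
Proof. by move=> h; have := rdist_triangle z w 0; rewrite !subr0; lra. Qed.

Lemma cauchy_formula_rnorm g r (z : C) : rnorm z < r ->
  derivable_on (rect (- r) r (- r) r) g ->
  g z * wind r z = rect_int (fun w => g w * (w - z)^-1) (- r) r (- r) r.
Proof. by case: z => p q /rnorm_lt_coord[/= pr qr] dg; exact: cauchy_formula. Qed.

Lemma wind_ge4_rnorm r (z : C) : rnorm z < r -> 4 <= rnorm (wind r z).
Proof. by case: z => p q /rnorm_lt_coord[/= pr qr]; exact: wind_ge4. Qed.

Lemma rnorm_neq0 (z : C) : 0 < rnorm z -> z != 0.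
Proof. by apply: contraTneq => ->; rewrite rnorm0 ltxx. Qed.

Lemma edge_neq_rnorm r x y (z : C) : rnorm z < r ->
  [\/ x = - r, x = r, y = - r | y = r] -> (x +i* y : C) != z.
Proof.
move=> zr h; rewrite -subr_eq0; apply: rnorm_neq0.
have r0 : 0 <= r by have := rnorm_ge0 z; lra.
by have := dist_lower z (edge_norm r0 h); lra.
Qed.

Lemma edge_cont_inv r (z : C) : rnorm z < r ->
  edge_cont (fun w : C => (w - z)^-1) (- r) r (- r) r.
Proof.
move=> zr; apply: derivable_edge => x y xI yI xy.
by apply: derivable_subVf; exact: edge_neq_rnorm xy.
Qed.

(** The difference is the integral of [1 / (w - z) - 1 / w], which is of order
    [1 / |w| ^ 2]; enlarging the contour to a square of half-side [A] does not
    change it and shows that it is of order [1 / A]. *)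
Lemma wind_const r (z : C) : rnorm z < r -> wind r z = wind r 0.
Proof.
move=> zr; have z0 := rnorm_ge0 z; have r0 : 0 < r by lra.
have r0r : rnorm (0 : C) < r by rewrite rnorm0.
pose h (w : C) := (w - z)^-1 + -1 * (w - 0)^-1.
have rr : - r <= r by lra.
have hE : rect_int h (- r) r (- r) r = wind r z - wind r 0.
  rewrite rect_intD//; last 2 first.
  - exact: edge_cont_inv.
  - by move=> x y xI yI xy; apply: continuousM; [exact: cst_continuous|exact: (edge_cont_inv r0r)].
  by rewrite rect_intZ ?mulN1r//; exact: edge_cont_inv.
apply/eqP; rewrite -subr_eq0 -hE; apply/eqP/rnorm_eq0/eqP.
rewrite eq_le rnorm_ge0 andbT; apply/ler_addgt0Pr => e e0; rewrite add0r.
pose A := r + 2 * rnorm z + 32 * rnorm z / e.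
have ze : 0 <= 32 * rnorm z / e by rewrite divr_ge0 ?mulr_ge0 ?rnorm_ge0 ?ltW.
have A1 : r <= A by rewrite /A; lra.
have A2 : 2 * rnorm z <= A by rewrite /A; lra.
have A3 : 32 * rnorm z <= e * A.
  rewrite -ler_pdivrMl// mulrC /A; lra.
have A0 : 0 < A by lra.
clearbody A.
have zA : rnorm z < A by lra.
have z0A : rnorm (0 : C) < A by rewrite rnorm0.
have AA : - A <= A by lra.
have dh w : r <= rnorm w -> derivable h w (1 : C).
  move=> rw; have w0 : w != 0 by apply: rnorm_neq0; lra.
  have wz : w != z by apply: contraTneq rw => ->; rewrite -ltNge.
  apply: derivableD; first exact: derivable_subVf.
  by apply: derivableM; [exact: derivable_cst|exact: derivable_subVf].
rewrite -(@rect_int_frame R h (- A) (- r) r A (- A) (- r) r A); last 7 first.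
- by lra.
- by lra.
- by lra.
- by lra.
- by lra.
- by lra.
- move=> x y _ _ xy; apply: dh; case: xy => xr.
  + apply: le_trans (Re_le_rnorm _); rewrite /= ler_normr; apply/orP; right; lra.
  + apply: le_trans (Re_le_rnorm _); rewrite /= ler_normr; apply/orP; left; lra.
  + apply: le_trans (Im_le_rnorm _); rewrite /= ler_normr; apply/orP; right; lra.
  + apply: le_trans (Im_le_rnorm _); rewrite /= ler_normr; apply/orP; left; lra.
apply: le_trans (rect_int_bound AA AA (M := 2 * rnorm z / A ^+ 2) _ _) _.
- by apply: derivable_edge => x y _ _ xy; apply: dh; apply: le_trans A1 (edge_norm _ xy); lra.
- move=> x y _ _ xy; rewrite /h subr0 mulN1r; set w : C := x +i* y.
  have w1 : A <= rnorm w by apply: edge_norm => //; lra.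
  have w2 : A / 2 <= rnorm (w - z) by have := dist_lower z w1; lra.
  have wn0 : w != 0 by apply: rnorm_neq0; lra.
  have wz0 : w - z != 0 by apply: rnorm_neq0; lra.
  have -> : (w - z)^-1 - w^-1 = z * (w * (w - z))^-1.
    by field; rewrite wn0 wz0.
  rewrite rnormM rnormV rnormM -mulrA mulrCA.
  apply: ler_wpM2l => //.
  have -> : 2 / A ^+ 2 = (A * (A / 2))^-1 by field; rewrite gt_eqF.
  rewrite lef_pV2 ?posrE; [|by apply: mulr_gt0; lra..].
  by apply: ler_pM => //; lra.
rewrite (_ : 4 * (2 * rnorm z / A ^+ 2) * (A - - A + (A - - A)) = 32 * rnorm z / A); last first.
  by field; rewrite gt_eqF.
by rewrite ler_pdivrMr.
Qed.

(** It identifies the coefficient that Cauchy's formula produces in [taylor2]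
    with the derivative. *)
Lemma slope_unique g (z a b : C) (K d : R) : 0 < d -> slope_at g z b ->
  (forall w, rnorm (w - z) <= d ->
     rnorm (g w - g z - a * (w - z)) <= K * rnorm (w - z) ^+ 2) -> a = b.
Proof.
move=> d0 sb Ka; apply/eqP; rewrite -subr_eq0; apply/eqP/rnorm_eq0/eqP.
rewrite eq_le rnorm_ge0 andbT; apply/ler_addgt0Pr => e e0; rewrite add0r.
have [d1 d10 hd1] := sb (e / 2) ltac:(lra).
pose K' := `|K| + 1.
have K'0 : 0 < K' by rewrite /K'; have := normr_ge0 K; lra.
have KK' : K <= K' by rewrite /K'; have := ler_norm K; lra.
pose t := Num.min d (Num.min (d1 / 2) (e / (2 * K'))).
have t0 : 0 < t.
  by rewrite !lt_min d0 !divr_gt0// mulr_gt0.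
have [td td1 te] : [/\ t <= d, t <= d1 / 2 & t <= e / (2 * K')].
  by split; rewrite /t !ge_min lexx ?orbT.
clearbody t; pose w : C := z + t%:C.
have wz : rnorm (w - z) = t by rewrite /w addrAC subrr add0r rnorm_pos// ltW.
have h1 := Ka w; rewrite wz in h1; have {}h1 := h1 td.
have h2 := hd1 w; rewrite wz in h2; have {}h2 := h2 ltac:(lra).
have : rnorm ((a - b) * (w - z)) <= K * t ^+ 2 + e / 2 * t.
  have -> : (a - b) * (w - z) = (g w - g z - b * (w - z)) - (g w - g z - a * (w - z)).
    by ring.
  by apply: le_trans (rnormB _ _) _; lra.
rewrite rnormM wz => h3.
have h4 : K * t ^+ 2 <= e / 2 * t.
  rewrite expr2 mulrA; apply: ler_wpM2r; first exact: ltW.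
  move: te; rewrite ler_pdivlMr ?mulr_gt0// => te.
  have : K * t <= K' * t by rewrite ler_pM2r.
  lra.
by rewrite -(ler_pM2r t0); lra.
Qed.

(** Integrate [1 / (w - z) = 1 / w + z / w ^ 2 + z ^ 2 / (w ^ 2 * (w - z))]
    against [g].  This gives an approximation with slope [a] defined by an
    integral; [a] is the derivative by [slope_unique]. *)
Lemma taylor2 g r (M : R) : 0 < r -> derivable_on (rect (- r) r (- r) r) g ->
  (forall z, rect (- r) r (- r) r z -> rnorm (g z) <= M) ->
  forall z, rnorm z <= r / 2 ->
    rnorm (g z - g 0 - 'D_1 g 0 * z) <= 8 * M / r ^+ 2 * rnorm z ^+ 2.
Proof.
move=> r0 dg gM.
have r0r : rnorm (0 : C) < r by rewrite rnorm0.
have rr : - r <= r by lra.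
have R0 : rect (- r) r (- r) r (0 : C) by split => /=; apply/andP; split; lra.
have M0 : 0 <= M by apply: le_trans (rnorm_ge0 _) (gM 0 R0).
pose c := wind r 0.
have c4 : 4 <= rnorm c by exact: wind_ge4_rnorm.
have c0 : c != 0 by apply: rnorm_neq0; lra.
have ecg : edge_cont g (- r) r (- r) r.
  by apply: derivable_edge => x y xI yI _; exact: dg.
have ecM f h : edge_cont f (- r) r (- r) r -> edge_cont h (- r) r (- r) r ->
    edge_cont (fun w => f w * h w) (- r) r (- r) r.
  move=> ef eh x y xI yI xy.
  exact: (continuousM (ef x y xI yI xy) (eh x y xI yI xy)).
have ei z : rnorm z < r -> edge_cont (fun w : C => (w - z)^-1) (- r) r (- r) r.
  exact: edge_cont_inv.
pose a := c^-1 * rect_int (fun w => g w * ((w - 0)^-1 * (w - 0)^-1)) (- r) r (- r) r.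
have main z : rnorm z <= r / 2 ->
    rnorm (g z - g 0 - a * z) <= 8 * M / r ^+ 2 * rnorm z ^+ 2.
  move=> zr2; have zr : rnorm z < r by have := rnorm_ge0 z; lra.
  pose F3 (w : C) := g w * ((w - 0)^-1 * (w - 0)^-1).
  pose F4 (w : C) := (g w * ((w - 0)^-1 * (w - 0)^-1)) * (w - z)^-1.
  have e3 : edge_cont F3 (- r) r (- r) r.
    by apply: (ecM _ _ ecg); apply: ecM; exact: ei.
  have e4 : edge_cont F4 (- r) r (- r) r.
    by apply: (ecM F3); [exact: e3|exact: ei].
  have eZ (k : C) f : edge_cont f (- r) r (- r) r -> edge_cont (fun w => k * f w) (- r) r (- r) r.
    by move=> ef x y xI yI xy; apply: continuousM; [exact: cst_continuous|exact: ef].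
  have eD f h : edge_cont f (- r) r (- r) r -> edge_cont h (- r) r (- r) r ->
    edge_cont (fun w => f w + h w) (- r) r (- r) r.
    move=> ef eh x y xI yI xy.
    exact: (continuousD (ef x y xI yI xy) (eh x y xI yI xy)).
  have E : rect_int (fun w => g w * (w - z)^-1) (- r) r (- r) r =
      rect_int (fun w => g w * (w - 0)^-1 + (z * F3 w + z ^+ 2 * F4 w)) (- r) r (- r) r.
    apply: eq_rect_int => // x y xI yI xy; rewrite /F4 /F3 !subr0.
    have h1 := edge_neq_rnorm zr xy; have h2 := edge_neq_rnorm r0r xy.
    move: h1 h2; set w : C := x +i* y => h1 h2.
    by field; rewrite h2 subr_eq0 h1.
  have Ec : (g z - g 0 - a * z) * c = z ^+ 2 * rect_int F4 (- r) r (- r) r.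
    have i0 := ecM _ _ ecg (ei 0 r0r).
    have i3 := eZ z _ e3.
    have i4 := eZ (z ^+ 2) _ e4.
    have e1 := cauchy_formula_rnorm zr dg.
    rewrite (wind_const zr) -/c E (rect_intD rr rr i0 (eD _ _ i3 i4)) in e1.
    rewrite (rect_intD rr rr i3 i4) (rect_intZ rr rr z e3) in e1.
    rewrite (rect_intZ rr rr (z ^+ 2) e4) -(cauchy_formula_rnorm r0r dg) -/c in e1.
    have ea : rect_int F3 (- r) r (- r) r = c * a by rewrite /a mulrA divff// mul1r.
    rewrite ea in e1.
    rewrite mulrBl mulrBl e1; ring.
  have B : rnorm (rect_int F4 (- r) r (- r) r) <= 32 * M / r ^+ 2.
    apply: le_trans (rect_int_bound rr rr (M := M * 2 / r ^+ 3) e4 _) _; last first.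
      rewrite le_eqVlt; apply/orP; left; apply/eqP; field.
      by rewrite gt_eqF.
    move=> x y xI yI xy; rewrite /F4 !subr0; set w : C := x +i* y.
    have w1 : r <= rnorm w by apply: edge_norm => //; lra.
    have w2 : r / 2 <= rnorm (w - z) by have := dist_lower z w1; lra.
    have -> : M * 2 / r ^+ 3 = M * (r * (r * (r / 2)))^-1.
      by field; rewrite gt_eqF.
    have -> : rnorm (g w * (w^-1 * w^-1) * (w - z)^-1) =
        rnorm (g w) * (rnorm w * (rnorm w * rnorm (w - z)))^-1.
      by rewrite !rnormM !rnormV !invfM !mulrA.
    have r20 : 0 <= r / 2 by lra.
    have r0' := ltW r0.
    have p1 : 0 < r * (r * (r / 2)) by rewrite !mulr_gt0//; lra.
    have p2 : r * (r * (r / 2)) <= rnorm w * (rnorm w * rnorm (w - z)).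
      by apply: ler_pM => //; [rewrite mulr_ge0|apply: ler_pM].
    apply: ler_pM; [exact: rnorm_ge0| |by apply: gM; split|].
      by rewrite invr_ge0 (le_trans (ltW p1)).
    by rewrite lef_pV2 ?posrE// (lt_le_trans p1).
  have B2 : rnorm (g z - g 0 - a * z) * rnorm c <= 32 * M / r ^+ 2 * rnorm z ^+ 2.
    by rewrite -rnormM Ec rnormM rnormX mulrC; apply: ler_wpM2r => //; rewrite exprn_ge0// rnorm_ge0.
  have B3 : rnorm (g z - g 0 - a * z) * 4 <= 32 * M / r ^+ 2 * rnorm z ^+ 2.
    by apply: le_trans B2; apply: ler_wpM2l => //; exact: rnorm_ge0.
  rewrite (_ : 32 * M / r ^+ 2 * rnorm z ^+ 2 = 8 * M / r ^+ 2 * rnorm z ^+ 2 * 4) in B3;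
    last by field; rewrite gt_eqF.
  by move: B3; rewrite ler_pM2r.
suff -> : 'D_1 g 0 = a by [].
apply/esym; apply: (@slope_unique g 0 a _ (8 * M / r ^+ 2) (r / 2)).
- by lra.
- by apply: derivable_slope; exact: dg.
by move=> w; rewrite !subr0; exact: main.
Qed.

End Taylor.

(** * The identity theorem on a square *)

Section Identity.
Variable R : realType.
Local Notation C := (Cplx R).
Implicit Types (f g : C -> C) (x y r s : R).

Lemma expr_lt (q K e : R) : 0 <= q < 1 -> 0 < e -> exists n, K * q ^+ n < e.
Proof.
move=> /andP[q0 q1] e0.
pose K' := `|K| + 1; have K'0 : 0 < K' by rewrite ltr_wpDl.
have /cvgrPdist_lt : (fun n => q ^+ n) @ \oo --> (0 : R).
  by apply: cvg_expr; rewrite ger0_norm.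
move=> /(_ (e / K') (divr_gt0 e0 K'0))[n _ /(_ n (leqnn n))] /=.
rewrite sub0r normrN ger0_norm ?exprn_ge0// ltr_pdivlMr// => h; exists n.
apply: le_lt_trans h; rewrite mulrC; apply: ler_wpM2l; first exact: exprn_ge0.
by rewrite /K'; have := ler_norm K; lra.
Qed.

Lemma cont_on_bounded (g : R -> C) (a b : R) : a <= b -> cont_on g a b ->
  exists M, forall t, a <= t <= b -> rnorm (g t) <= M.
Proof.
move=> ab gc; have [|c _ hc] := @EVT_max R (fun t => rnorm (g t)) a b ab.
  apply: continuous_in_subspaceT => t; rewrite inE /= in_itv /= => /gc tc.
  apply/cvgrPdist_lt => e /tc[d d0 hd].
  apply/nbhs_ballP; exists d => //= s; rewrite /ball /= distrC => /hd h.
  apply: le_lt_trans h; rewrite ler_norml; apply/andP; split.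
    by have := rdist_triangle (g t) (g s) 0; rewrite !subr0; lra.
  by have := rdist_triangle (g s) (g t) 0; rewrite !subr0 rdistC; lra.
by exists (rnorm (g c)) => t tab; apply: hc; rewrite in_itv.
Qed.

Lemma edge_bounded f r : 0 <= r -> edge_cont f (- r) r (- r) r ->
  exists2 M, 0 <= M & on_edge (- r) r (- r) r (fun z => rnorm (f z) <= M).
Proof.
move=> r0 ec; have rr : - r <= r by lra.
have [c1 c2 c3 c4] := edge_on rr rr ec.
have [M1 h1] := cont_on_bounded rr c1; have [M2 h2] := cont_on_bounded rr c2.
have [M3 h3] := cont_on_bounded rr c3; have [M4 h4] := cont_on_bounded rr c4.
pose M := Num.max (Num.max M1 M2) (Num.max M3 M4).
have H : on_edge (- r) r (- r) r (fun z => rnorm (f z) <= M).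
  move=> x y xI yI xy; case: xy => E; rewrite E in xI yI *.
  - by rewrite /M !le_max h3 ?orbT.
  - by rewrite /M !le_max h4 ?orbT.
  - by rewrite /M !le_max h1 ?orbT.
  - by rewrite /M !le_max h2 ?orbT.
exists M => //; apply: le_trans (H r r _ _ _); rewrite ?rnorm_ge0 ?lexx ?andbT//.
by constructor 2.
Qed.

(** Since [g] vanishes near [0], [g w / w ^ n] is differentiable on the whole
    square for every [n], and Cauchy's formula for it bounds [g z] by a constant
    times [(|z| / r) ^ n]. *)
Lemma identity_square g r s : 0 < s -> derivable_on (rect (- r) r (- r) r) g ->
  (forall z, rnorm z < s -> g z = 0) -> forall z, rnorm z < r -> g z = 0.
Proof.
move=> s0 dg gs z zr.
have [->|z0] := eqVneq z 0; first by apply: gs; rewrite rnorm0.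
have zp := rnorm_gt0 z0; have r0 : 0 < r by lra.
have rr : - r <= r by lra.
have ecg : edge_cont g (- r) r (- r) r.
  by apply: derivable_edge => x y xI yI _; exact: dg.
have [M M0 gM] := edge_bounded (ltW r0) ecg.
pose q := rnorm z / r.
have q01 : 0 <= q < 1 by rewrite divr_ge0 ?ltW//= ltr_pdivrMr ?mul1r.
pose K := 8 * M * r / (r - rnorm z).
have rz : 0 < r - rnorm z by lra.
suff B n : rnorm (g z) <= K * q ^+ n.
  apply: rnorm_eq0; apply/eqP; rewrite eq_le rnorm_ge0 andbT.
  apply/ler_addgt0Pr => e e0; rewrite add0r.
  by have [n hn] := @expr_lt q K e q01 e0; apply: le_trans (ltW hn).
pose h (w : C) := g w * (w ^+ n)^-1.
have dh : derivable_on (rect (- r) r (- r) r) h.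
  move=> w wR; have [w0|w0] := eqVneq w 0.
    (* Near [0] the quotient is constantly [0], whatever [n]. *)
    have : derivable (cst (0 : C)) w (1 : C) by exact: derivable_cst.
    apply: near_eq_derivable.
    rewrite w0; apply/nbhs_rballP; exists s => // u; rewrite subr0 => us /=.
    by rewrite /h gs// mul0r.
  apply: derivableM; first exact: dg.
  apply: (@derivableV _ _ (fun w : C => w ^+ n)); first by rewrite expf_neq0.
  exact: exprn_derivable.
have ech : edge_cont (fun w => h w * (w - z)^-1) (- r) r (- r) r.
  apply: derivable_edge => x y xI yI xy; apply: derivableM; first exact: dh.
  by apply: derivable_subVf; exact: edge_neq_rnorm xy.
have F := cauchy_formula_rnorm zr dh.
have w4 := wind_ge4_rnorm zr.
pose b := M / r ^+ n / (r - rnorm z).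
have B1 : rnorm (h z * wind r z) <= 4 * b * (r - - r + (r - - r)).
  rewrite F; apply: (rect_int_bound rr rr ech) => x y xI yI xy.
  have gb := gM x y xI yI xy; set w : C := x +i* y in gb *.
  have w1 : r <= rnorm w by apply: edge_norm => //; exact: ltW.
  have w2 : r - rnorm z <= rnorm (w - z) by exact: dist_lower.
  rewrite /h !rnormM !rnormV rnormX.
  have rn0 : 0 < r ^+ n by rewrite exprn_gt0.
  have wn : r ^+ n <= rnorm w ^+ n by rewrite lerXn2r// ?nnegrE ?rnorm_ge0// ltW.
  apply: ler_pM.
  - by rewrite mulr_ge0 ?rnorm_ge0// invr_ge0 exprn_ge0 ?rnorm_ge0.
  - by rewrite invr_ge0 rnorm_ge0.
  - apply: ler_pM => //; rewrite ?rnorm_ge0// ?invr_ge0 ?exprn_ge0 ?rnorm_ge0//.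
    by rewrite lef_pV2 ?posrE// (lt_le_trans rn0).
  - by rewrite lef_pV2 ?posrE// (lt_le_trans rz).
have hz : rnorm (h z) = rnorm (g z) / rnorm z ^+ n by rewrite rnormM rnormV rnormX.
have B2 : rnorm (h z) * 4 <= 16 * r * b.
  apply: le_trans (_ : rnorm (h z * wind r z) <= _).
    by rewrite rnormM; apply: ler_wpM2l => //; exact: rnorm_ge0.
  by apply: le_trans B1 _; lra.
have zn : 0 < rnorm z ^+ n by rewrite exprn_gt0.
rewrite hz in B2.
have -> : K * q ^+ n = (4 * r * b * rnorm z ^+ n) * 2.
  rewrite /K /q /b expr_div_n; field.
  by rewrite !gt_eqF ?exprn_gt0.
have B3 : rnorm (g z) / rnorm z ^+ n <= 4 * r * b by lra.
rewrite ler_pdivrMr// in B3; apply: le_trans B3 _.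
have b0 : 0 <= b by rewrite /b; apply: divr_ge0;
  [apply: divr_ge0 => //; exact: exprn_ge0 (ltW r0)|exact: ltW].
have r0w := ltW r0; have znw := ltW zn.
have : 0 <= 4 * r * b * rnorm z ^+ n by apply: mulr_ge0 => //; apply: mulr_ge0 => //; apply: mulr_ge0.
lra.
Qed.

End Identity.

(** * Holomorphic functions of several variables *)

Section SeveralVariables.
Variable R : realType.
Local Notation C := (Cplx R).

Lemma derivable_line (V : normedModType C) (F : V -> C) (z v : V) (t : C) :
  differentiable F (z + t *: v) ->
  derivable (fun s : C => F (z + s *: v)) t (1 : C) /\
  'D_1 (fun s : C => F (z + s *: v)) t = 'd F (z + t *: v) v.
Proof.
move=> dF; have dv : derivable F (z + t *: v) v by exact: diff_derivable.
have E : (fun h : C => h^-1 *: (((fun s : C => F (z + s *: v)) \o shift t) (h *: (1 : C)) -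
      F (z + t *: v))) =
    (fun h : C => h^-1 *: ((F \o shift (z + t *: v)) (h *: v) - F (z + t *: v))).
  apply/funext => h /=; congr (_ *: (F _ - _)).
  by rewrite [h *: 1]mulr1 scalerDl addrCA.
split; first by rewrite /derivable E.
by rewrite /derive E -deriveE.
Qed.

(** Apply [identity_square] on the complex line through [z] and [w].  The
    factor 8 leaves room for a square around [z] that contains [w] and whose
    image on that line stays in the ball. *)
Lemma identity_ball (V : normedModType C) (F : V -> C) (x z w : V) (rho s : R) :
  (forall y, rnorm (y - x) < rho -> differentiable F y) ->
  0 < s -> (forall y, rnorm (y - z) < s -> F y = 0) ->
  rnorm (z - x) < rho / 8 -> rnorm (w - x) < rho / 8 -> F w = 0.
Proof.
move=> dF s0 Fs zx wx.
pose u := w - z.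
have uu : rnorm u < rho / 4.
  by have := rdist_triangle x w z; rewrite (rdistC x z) -/u; lra.
pose g (t : C) := F (z + t *: u).
have -> : F w = g 1 by rewrite /g scale1r /u addrC subrK.
have u0 := rnorm_ge0 u.
apply: (@identity_square R g (3 / 2) (s / (rnorm u + 1))).
- by rewrite divr_gt0//; lra.
- move=> t [/andP[t1 t2] /andP[t3 t4]].
  have [] // := @derivable_line V F z u t.
  apply: dF; rewrite addrAC.
  apply: le_lt_trans (rnormD _ _) _; rewrite rnormZ.
  have t5 : rnorm t <= 3.
    apply: le_trans (rnorm_le_ReIm _) _.
    have : `|complex.Re t| <= 3 / 2 by rewrite ler_norml t2 andbT; lra.
    have : `|complex.Im t| <= 3 / 2 by rewrite ler_norml t4 andbT; lra.
    lra.
  have : rnorm t * rnorm u <= 3 * rnorm u by apply: ler_wpM2r.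
  lra.
- move=> t; rewrite ltr_pdivlMr; last by lra.
  move=> ts; apply: Fs; rewrite addrAC subrr add0r rnormZ.
  have := rnorm_ge0 t; nra.
- by rewrite rnorm1; lra.
Qed.

(** The set of points near which [F] vanishes is open, and by [identity_ball]
    it is relatively closed in [W]. *)
Theorem identity_theorem (V : normedModType C) (W : set V) (F : V -> C) (x0 : V) (e0 : R) :
  open W -> connected W -> (forall y, W y -> differentiable F y) ->
  0 < e0 -> W x0 -> (forall y, rnorm (y - x0) < e0 -> F y = 0) ->
  forall y, W y -> F y = 0.
Proof.
move=> oW cW dF e00 Wx0 F0.
pose Z : set V := [set x | exists2 e : R, 0 < e & forall y, rnorm (y - x) < e -> F y = 0].
have oZ : open Z.
  rewrite openE => x [e ee he]; apply/nbhs_rballP; exists (e / 2); first by lra.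
  move=> y yx; exists (e / 2); first by lra.
  move=> z zy; apply: he; have := rdist_triangle y z x; lra.
suff WZ : W `&` Z = W.
  move=> y Wy; have : (W `&` Z) y by rewrite WZ.
  by case=> _ [e ee he]; apply: he; rewrite subrr rnorm0.
apply: cW.
- by exists x0; split => //; exists e0.
- by exists Z.
exists (closure Z); first exact: closed_closure.
apply/seteqP; split => x [Wx Zx]; split => //; first exact: subset_closure.
have [rho rho0 hrho] := openP_rball oW Wx.
have [] := Zx [set y | rnorm (y - x) < rho / 8].
  by apply/nbhs_rballP; exists (rho / 8) => //; lra.
move=> z [[s s0 hs] zx]; exists (rho / 8); first by lra.
move=> y yx; apply: (@identity_ball V F x z y rho s) => //.
by move=> u ux; apply: dF; exact: hrho.
Qed.

(** [taylor2] on the complex line through [x] and [x + h], parametrized so that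
    [h] is reached at time [1]; the half-side [r] of the square is inversely
    proportional to the norm of [h], which turns the constant of [taylor2] into a multiple
    of the square of the norm of [h]. *)
Lemma second_order (V : normedModType C) (F : V -> C) (x0 : V) (rho : R) : 0 < rho ->
  (forall y, rnorm (y - x0) < rho -> differentiable F y) ->
  exists r K, [/\ 0 < r, 0 <= K & forall x h, rnorm (x - x0) < r -> rnorm h <= r ->
    rnorm (F (x + h) - F x - 'd F x h) <= K * rnorm h ^+ 2].
Proof.
move=> rho0 dF.
have /continuous_rnormP/(_ 1 ltr01)[d d0 hd] : {for x0, continuous F}.
  by apply: differentiable_continuous; apply: dF; rewrite subrr rnorm0.
pose M := rnorm (F x0) + 1.
pose s := Num.min rho d.
have s0 : 0 < s by rewrite lt_min rho0.
have [sr sd] : s <= rho /\ s <= d by rewrite /s !ge_min !lexx orbT.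
clearbody s.
have FM y : rnorm (y - x0) < s -> rnorm (F y) <= M.
  move=> ys; have := rnormD (F y - F x0) (F x0); rewrite subrK /M.
  by have := hd y ltac:(lra); lra.
exists (s / 8), (128 * M / s ^+ 2).
have M0 : 0 <= M by rewrite /M; have := rnorm_ge0 (F x0); lra.
split; [by lra|by apply: divr_ge0; [exact: mulr_ge0|exact: exprn_ge0 (ltW s0)]|].
move=> x h xx hs.
have [->|h0] := eqVneq h 0; first by rewrite addr0 subrr linear0 subrr !rnorm0 expr0n/= mulr0.
have hp := rnorm_gt0 h0.
pose g (t : C) := F (x + t *: h).
pose r := s / (4 * rnorm h).
have r0 : 0 < r by rewrite divr_gt0// mulr_gt0.
have rh : r * rnorm h = s / 4 by rewrite /r; field; rewrite gt_eqF.
have inball t : rect (- r) r (- r) r t -> rnorm (x + t *: h - x0) < s.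
  move=> [/andP[t1 t2] /andP[t3 t4]]; rewrite addrAC.
  apply: le_lt_trans (rnormD _ _) _; rewrite rnormZ.
  have t5 : rnorm t <= 2 * r.
    apply: le_trans (rnorm_le_ReIm _) _.
    have : `|complex.Re t| <= r by rewrite ler_norml t1.
    have : `|complex.Im t| <= r by rewrite ler_norml t3.
    lra.
  have : rnorm t * rnorm h <= 2 * r * rnorm h by rewrite ler_pM2r.
  by rewrite -mulrA rh; lra.
have dg : derivable_on (rect (- r) r (- r) r) g.
  move=> t /inball tb; have [] // := @derivable_line V F x h t.
  by apply: dF; apply: lt_le_trans sr.
have gM t : rect (- r) r (- r) r t -> rnorm (g t) <= M by move=> /inball; exact: FM.
have := taylor2 r0 dg gM (z := 1).
rewrite rnorm1 expr1n mulr1 => /(_ _).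
have r2 : 1 <= r / 2.
  rewrite /r ler_pdivlMr// mul1r ler_pdivlMr ?mulr_gt0//; lra.
move=> /(_ r2).
have [_ ->] := @derivable_line V F x h 0 ltac:(by rewrite scale0r addr0; apply: dF; lra).
rewrite scale0r addr0 mulr1 /g scale1r scale0r addr0 => B.
apply: le_trans B _; rewrite le_eqVlt; apply/orP; left; apply/eqP.
by rewrite /r; field; rewrite !gt_eqF.
Qed.

(** The Lipschitz bound on the derivative follows from the second-order bound:
    for [k] parallel to [h] and of the size of [e := x' - x], expand
    [F (x' + k)] around [x'] and around [x], and [F x'] around [x]. *)
Lemma local_C2 (V : normedModType C) (F : V -> C) (x0 : V) (rho : R) : 0 < rho ->
  (forall y, rnorm (y - x0) < rho -> differentiable F y) ->
  exists r K, [/\ 0 < r, 0 <= K,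
   (forall x h, rnorm (x - x0) < r -> rnorm h <= r ->
      rnorm (F (x + h) - F x - 'd F x h) <= K * rnorm h ^+ 2) &
   (forall x x' h, rnorm (x - x0) < r -> rnorm (x' - x0) < r ->
      rnorm ('d F x' h - 'd F x h) <= K * rnorm (x' - x) * rnorm h)].
Proof.
move=> rho0 dF; have [r [K [r0 K0 H]]] := second_order rho0 dF.
exists (r / 4), (6 * K); split; [by lra|by lra| |].
  move=> x h xx hr; apply: le_trans (H x h _ _) _; [by lra|by lra|].
  have := sqr_ge0 (rnorm h); nra.
move=> x x' h xx xx'.
have [->|h0] := eqVneq h 0; first by rewrite !linear0 ?subrr ?addr0 !rnorm0 !mulr0.
have [->|ne] := eqVneq x' x; first by rewrite !subrr !rnorm0 mulr0 mul0r.
have hp := rnorm_gt0 h0.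
pose e := x' - x; pose de := rnorm e.
have dp : 0 < de by apply: rnorm_gt0; rewrite subr_eq0.
have de2 : de <= r / 2.
  by have := rdist_triangle x0 x' x; rewrite (rdistC x0) -/e -/de; lra.
pose c : C := (de / rnorm h)%:C.
have cp : rnorm c = de / rnorm h by rewrite rnorm_pos// divr_ge0 ?ltW.
pose k := c *: h.
have kd : rnorm k = de by rewrite rnormZ cp divfK// gt_eqF.
have A1 := H x' k ltac:(lra) ltac:(lra).
have ek : rnorm (e + k) <= 2 * de by apply: le_trans (rnormD _ _) _; rewrite kd -/de; lra.
have A2 := H x (e + k) ltac:(lra) ltac:(lra).
have A3 := H x e ltac:(lra) ltac:(rewrite -/de; lra).
have xe : x + e = x' by rewrite /e addrC subrK.
rewrite addrA xe in A2; rewrite xe in A3.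
rewrite kd in A1; rewrite -/de in A3.
have A2' : rnorm (F (x' + k) - F x - 'd F x (e + k)) <= K * (2 * de) ^+ 2.
  apply: le_trans A2 _; apply: ler_wpM2l => //.
  by rewrite lerXn2r// nnegrE ?rnorm_ge0// mulr_ge0// ltW.
have key : rnorm ('d F x' k - 'd F x k) <= 6 * K * de ^+ 2.
  have -> : 'd F x' k - 'd F x k =
     (F (x' + k) - F x - 'd F x (e + k)) - (F (x' + k) - F x' - 'd F x' k) -
     (F x' - F x - 'd F x e) by rewrite linearD; ring.
  apply: le_trans (rnormB _ _) _; apply: le_trans (lerD (rnormB _ _) (lexx _)) _.
  by move: A1 A2' A3; rewrite exprMn; lra.
have kk y : 'd F y k = c * 'd F y h by rewrite linearZ.
rewrite !kk -mulrBr rnormM cp in key.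
rewrite -(ler_pM2l (divr_gt0 dp hp)); apply: le_trans key _.
rewrite le_eqVlt; apply/orP; left; apply/eqP; rewrite -/e -/de; field.
by rewrite gt_eqF.
Qed.

End SeveralVariables.

(** * Row vectors and finite families of functions *)

Section RowVectors.
Variable R : realType.
Local Notation C := (Cplx R).

Lemma rnorm_row_lt d (v : 'rV[C]_d) (e : R) : 0 < e ->
  (rnorm v < e <-> forall i, rnorm (v ord0 i) < e).
Proof.
move=> e0.
have E : ball (0 : 'rV[C]_d) e%:C v <-> rnorm v < e.
  by rewrite mx_norm_ball /ball_ /= sub0r normrN rnormE ltcR.
rewrite -E; split.
  move=> h i; have [_ /(_ ord0 i)] := h.
  by rewrite -ball_normE /= mxE sub0r normrN rnormE ltcR.
move=> h; split; first by rewrite ltcE /= eqxx.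
by move=> i j; rewrite (ord1 i) -ball_normE /= mxE sub0r normrN rnormE ltcR.
Qed.

Lemma rnorm_coord d (v : 'rV[C]_d) i : rnorm (v ord0 i) <= rnorm v.
Proof.
apply/ler_addgt0Pr => e e0; apply: ltW.
have v0 := rnorm_ge0 v.
have [h _] := @rnorm_row_lt d v (rnorm v + e) ltac:(lra).
by apply: h; lra.
Qed.

Lemma rnorm_row_le d (v : 'rV[C]_d) (c : R) : 0 <= c ->
  (forall i, rnorm (v ord0 i) <= c) -> rnorm v <= c.
Proof.
move=> c0 h; apply/ler_addgt0Pr => e e0; apply: ltW.
by apply/rnorm_row_lt; [lra|move=> i; apply: le_lt_trans (h i) _; lra].
Qed.

Lemma rnorm_row_attained d (v : 'rV[C]_d) : v != 0 ->
  exists i, rnorm (v ord0 i) = rnorm v.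
Proof.
move=> v0; apply: contrapT => /forallNP h.
have lt i : rnorm (v ord0 i) < rnorm v.
  by rewrite lt_neqAle rnorm_coord andbT; apply/eqP; exact: h.
by have := (rnorm_row_lt v (rnorm_gt0 v0)).2 lt; rewrite ltxx.
Qed.

Lemma geom_complete_row d (u : nat -> 'rV[C]_d) (M : R) :
  (forall n, rnorm (u n.+1 - u n) <= M * 2^-1 ^+ n) ->
  exists l, forall n, rnorm (u n - l) <= 4 * M * 2^-1 ^+ n.
Proof.
move=> uM.
have H i : exists l, forall n, rnorm (u n ord0 i - l) <= 4 * M * 2^-1 ^+ n.
  apply: geom_complete_C => n; apply: le_trans (uM n).
  by apply: le_trans (rnorm_coord _ i); rewrite !mxE.
have [l hl] := choice H.
exists (\row_i l i) => n; apply: rnorm_row_le.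
  have := uM 0%N; rewrite expr0 mulr1 => M0.
  have {}M0 : 0 <= M by apply: le_trans M0; exact: rnorm_ge0.
  by rewrite mulr_ge0 ?mulr_ge0// exprn_ge0// invr_ge0.
by move=> i; rewrite !mxE.
Qed.

Lemma le_sum_nneg n (f : 'I_n -> R) i : (forall j, 0 <= f j) -> f i <= \sum_j f j.
Proof. by move=> f0; rewrite (bigD1 i)//= lerDl sumr_ge0. Qed.

Lemma local_C2_family (V : normedModType C) n (F : 'I_n -> V -> C) (x0 : V) (rho : R) : 0 < rho ->
  (forall i y, rnorm (y - x0) < rho -> differentiable (F i) y) ->
  exists r K, [/\ 0 < r, 0 <= K,
   (forall i x h, rnorm (x - x0) < r -> rnorm h <= r ->
      rnorm (F i (x + h) - F i x - 'd (F i) x h) <= K * rnorm h ^+ 2) &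
   (forall i x x' h, rnorm (x - x0) < r -> rnorm (x' - x0) < r ->
      rnorm ('d (F i) x' h - 'd (F i) x h) <= K * rnorm (x' - x) * rnorm h)].
Proof.
move=> rho0 dF.
have [r H] := choice (fun i => local_C2 rho0 (dF i)).
have [K {}H] := choice H.
have r0 i : 0 < r i by have [] := H i.
have K0 i : 0 <= K i by have [] := H i.
(* [S^-1] serves as a common positive lower bound of the radii [r i], also
   when the family is empty. *)
pose S := 1 + \sum_i (r i)^-1.
have S0 : 0 < S by rewrite ltr_pwDl// sumr_ge0// => i _; rewrite invr_ge0 ltW.
have rS i : S^-1 <= r i.
  rewrite invf_ple ?posrE//; apply: le_trans (le_sum_nneg (f := fun i => (r i)^-1) i _) _.
    by move=> j; rewrite invr_ge0 ltW.
  by rewrite /S lerDr.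
have KS i : K i <= \sum_j K j by exact: le_sum_nneg.
exists S^-1, (\sum_j K j); split.
- by rewrite invr_gt0.
- by apply: sumr_ge0.
- move=> i x h xx hh; have [_ _ h1 _] := H i.
  apply: le_trans (h1 x h (lt_le_trans xx (rS i)) (le_trans hh (rS i))) _.
  by rewrite ler_wpM2r// exprn_ge0// rnorm_ge0.
move=> i x x' h xx xx'; have [_ _ _ h1] := H i.
apply: le_trans (h1 x x' h (lt_le_trans xx (rS i)) (lt_le_trans xx' (rS i))) _.
by rewrite ler_wpM2r ?rnorm_ge0// ler_wpM2r ?rnorm_ge0.
Qed.

End RowVectors.

(** * Maps with a continuous left inverse have nonsingular points *)

Section Maps.
Variable R : realType.
Local Notation C := (Cplx R).
Variables (d n : nat) (F : 'I_n -> 'rV[C]_d -> C).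

Definition vmap (x : 'rV[C]_d) : 'rV[C]_n := \row_i F i x.
Definition vdiff (x h : 'rV[C]_d) : 'rV[C]_n := \row_i 'd (F i) x h.

Lemma vdiff_linear x : linear (vdiff x).
Proof.
by move=> a u v; apply/rowP => i; rewrite !mxE linearD linearZ.
Qed.

HB.instance Definition _ x := GRing.isLinear.Build C 'rV[C]_d 'rV[C]_n *:%R (vdiff x) (vdiff_linear x).

Lemma local_C2_map (x0 : 'rV[C]_d) (rho : R) : 0 < rho ->
  (forall i y, rnorm (y - x0) < rho -> differentiable (F i) y) ->
  exists r K, [/\ 0 < r, 0 <= K,
   (forall x h, rnorm (x - x0) < r -> rnorm h <= r ->
      rnorm (vmap (x + h) - vmap x - vdiff x h) <= K * rnorm h ^+ 2) &
   (forall x x' h, rnorm (x - x0) < r -> rnorm (x' - x0) < r ->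
      rnorm (vdiff x' h - vdiff x h) <= K * rnorm (x' - x) * rnorm h)].
Proof.
move=> rho0 dF; have [r [K [r0 K0 h1 h2]]] := local_C2_family rho0 dF.
exists r, K; split => //.
  move=> x h xx hh; apply: rnorm_row_le.
    by rewrite mulr_ge0// exprn_ge0// rnorm_ge0.
  by move=> i; rewrite !mxE; exact: h1.
move=> x x' h xx xx'; apply: rnorm_row_le.
  by rewrite !mulr_ge0// rnorm_ge0.
by move=> i; rewrite !mxE; exact: h2.
Qed.

(** Asking for small images instead of a kernel vector makes the condition
    closed in [x] without a compactness argument, and is enough for the
    polygons below.  The index [k] records a coordinate of [v] of maximal
    modulus. *)
Definition almost_kernel (k : 'I_d) (x : 'rV[C]_d) := forall e : R, 0 < e ->
  exists v : 'rV[C]_d, [/\ rnorm v <= 1, v ord0 k = 1 & rnorm (vdiff x v) <= e].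

Lemma almost_kernel_ex x : (forall c : R, 0 < c -> exists h, rnorm (vdiff x h) < c * rnorm h) ->
  exists k, almost_kernel k x.
Proof.
move=> sing; apply: contrapT => /forallNP nk.
have H k : exists e : R, 0 < e /\ forall v : 'rV[C]_d, rnorm v <= 1 -> v ord0 k = 1 -> e < rnorm (vdiff x v).
  have /existsNP[e /not_implyP[e0 he]] := nk k.
  exists e; split=> // v v1 vk; rewrite ltNge; apply/negP => ve.
  by apply: he; exists v.
have [e he] := choice H.
have e0 k : 0 < e k by have [] := he k.
pose S := 1 + \sum_i (e i)^-1.
have S0 : 0 < S by rewrite ltr_pwDl// sumr_ge0// => i _; rewrite invr_ge0 ltW.
have [h hh] := sing S^-1 ltac:(by rewrite invr_gt0).
have h0 : h != 0.
  by apply: contraTneq hh => ->; rewrite linear0 !rnorm0 mulr0 ltxx.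
have hp := rnorm_gt0 h0.
have [k hk] := rnorm_row_attained h0.
have hk0 : h ord0 k != 0 by apply: rnorm_neq0; rewrite hk.
pose v := (h ord0 k)^-1 *: h.
have v1 : rnorm v = 1 by rewrite rnormZ rnormV hk mulVf// gt_eqF.
have vk : v ord0 k = 1 by rewrite mxE mulVf.
have [_ /(_ v)] := he k; rewrite v1 lexx => /(_ isT vk).
rewrite linearZ rnormZ rnormV hk ltNge => /negP; apply.
rewrite mulrC ler_pdivrMr//; apply: le_trans (ltW hh) _; apply: ler_wpM2r; first exact: ltW.
rewrite invf_ple ?posrE//; apply: le_trans (le_sum_nneg (f := fun i => (e i)^-1) k _) _.
  by move=> j; rewrite invr_ge0 ltW.
by rewrite /S lerDr.
Qed.

Lemma almost_kernel_open k x (rho : R) : 0 < rho ->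
  (forall i y, rnorm (y - x) < rho -> differentiable (F i) y) ->
  ~ almost_kernel k x ->
  exists2 s : R, 0 < s & forall y, rnorm (y - x) < s -> ~ almost_kernel k y.
Proof.
move=> rho0 dF /existsNP[e /not_implyP[e0 he]].
have [r [K [r0 K0 _ lip]]] := local_C2_map rho0 dF.
have K1 : 0 < 2 * (K + 1) by lra.
pose s := Num.min r (e / (2 * (K + 1))).
have s0 : 0 < s by rewrite lt_min r0 divr_gt0.
have [sr se] : s <= r /\ s <= e / (2 * (K + 1)) by rewrite /s !ge_min !lexx orbT.
clearbody s; exists s => // y yx ak.
have [v [v1 vk vv]] := ak (e / 2) ltac:(lra).
apply: he; exists v; split => //.
have := lip x y v ltac:(by rewrite subrr rnorm0) ltac:(lra).
rewrite ler_pdivlMr// in se.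
have h1 : K * rnorm (y - x) * rnorm v <= e / 2.
  have y0 := rnorm_ge0 (y - x); have v0 := rnorm_ge0 v.
  have h2 : K * rnorm (y - x) * rnorm v <= K * rnorm (y - x) * 1.
    by apply: ler_wpM2l => //; rewrite mulr_ge0.
  have h3 : K * rnorm (y - x) <= K * s by apply: ler_wpM2l => //; exact: ltW.
  nra.
move: (vdiff x v) (vdiff y v) vv => A B vv h4.
by have := rdist_triangle B A 0; rewrite !subr0 (rdistC A B); lra.
Qed.

(** By induction on the list of indices: either [k] works on the whole ball, or
    it fails on a smaller ball by [almost_kernel_open], where only the other
    indices remain. *)
Lemma almost_kernel_ball (s : seq 'I_d) a (rho : R) : 0 < rho ->
  (forall i y, rnorm (y - a) < rho -> differentiable (F i) y) ->
  (forall x, rnorm (x - a) < rho -> exists2 k, k \in s & almost_kernel k x) ->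
  exists k b t, [/\ 0 < t, forall y, rnorm (y - b) < t -> rnorm (y - a) < rho &
     forall x, rnorm (x - b) < t -> almost_kernel k x].
Proof.
elim: s a rho => [|k s IH] a rho rho0 dF ex.
  by have [|k] := ex a; rewrite ?subrr ?rnorm0.
have [all_k|] := pselect (forall x, rnorm (x - a) < rho -> almost_kernel k x).
  by exists k, a, rho.
move=> /existsNP[x /not_implyP[xa nk]].
have sub y : rnorm (y - x) < rho - rnorm (x - a) -> rnorm (y - a) < rho.
  by move=> yx; have := rdist_triangle x y a; lra.
have [||t t0 ht] := @almost_kernel_open k x (rho - rnorm (x - a)) _ _ nk.
- by rewrite subr_gt0.
- by move=> i y /sub; exact: dF.
pose r := Num.min t (rho - rnorm (x - a)).
have r0 : 0 < r by rewrite lt_min t0 subr_gt0.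
have [rt rr] : r <= t /\ r <= rho - rnorm (x - a) by rewrite /r !ge_min !lexx orbT.
clearbody r.
have sub' y : rnorm (y - x) < r -> rnorm (y - a) < rho by move=> yx; apply: sub; lra.
have [||k' [b [u [u0 hu1 hu2]]]] := IH x r r0.
- by move=> i y /sub'; exact: dF.
- move=> y yx; have [k' k's ak] := ex y (sub' _ yx).
  move: k's; rewrite inE => /predU1P[E|k's]; last by exists k'.
  by rewrite E in ak; case: (ht y (lt_le_trans yx rt) ak).
by exists k', b, u; split => // y /hu1 /sub'.
Qed.

(** [N] steps of length [T / N] along almost kernel vectors move the [k]-th
    coordinate by exactly [T]; by the second-order bound the map changes by at
    most [N * (eps * (T / N) + K * (T / N) ^ 2)], which is small for small [eps]
    and large [N]. *)
Lemma euler_polygon k b (t : R) : 0 < t ->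
  (forall i y, rnorm (y - b) < t -> differentiable (F i) y) ->
  (forall x, rnorm (x - b) < t -> almost_kernel k x) ->
  exists T : R, [/\ 0 < T, T < t & forall e : R, 0 < e ->
    exists x, [/\ rnorm (x - b) <= T, x ord0 k = b ord0 k + T%:C &
      rnorm (vmap x - vmap b) < e]].
Proof.
move=> t0 dF ak; have [r [K [r0 K0 H _]]] := local_C2_map t0 dF.
pose T := Num.min t r / 2.
have m0 : 0 < Num.min t r by rewrite lt_min t0.
have [Tt Tr] : T < t /\ T < r.
  have : Num.min t r <= t by rewrite ge_min lexx.
  have : Num.min t r <= r by rewrite ge_min lexx orbT.
  by rewrite /T; split; lra.
have T0 : 0 < T by rewrite /T; lra.
clearbody T; exists T; split=> // e e0.
pose eps := e / (4 * T).
have eps0 : 0 < eps by rewrite divr_gt0// mulr_gt0.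
pose N := (Num.truncn (4 * K * T ^+ 2 / e)).+1.
have NK : 4 * K * T ^+ 2 / e < N%:R by exact: truncnS_gt.
have N0 : 0 < N%:R :> R by rewrite ltr0n.
clearbody N.
pose tau := T / N%:R.
have tau0 : 0 < tau by rewrite divr_gt0.
have NT : N%:R * tau = T by rewrite /tau mulrC divfK// gt_eqF.
have P j : (j <= N)%N -> exists x, [/\ rnorm (x - b) <= j%:R * tau,
   x ord0 k = b ord0 k + (j%:R * tau)%:C &
   rnorm (vmap x - vmap b) <= j%:R * (eps * tau + K * tau ^+ 2)].
  elim: j => [_|j IH jN].
    by exists b; rewrite !subrr !rnorm0 !mul0r addr0.
  have [x [x1 x2 x3]] := IH (ltnW jN).
  have jT : j%:R * tau <= T.
    by rewrite -NT ler_pM2r// ler_nat ltnW.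
  have xt : rnorm (x - b) < t by lra.
  have [v [v1 vk vv]] := ak x xt eps eps0.
  have tv : rnorm (tau%:C *: v) <= tau.
    rewrite rnormZ rnorm_pos; last exact: ltW.
    by rewrite -[leRHS]mulr1 ler_pM2l.
  have jS : j.+1%:R = j%:R + 1 :> R by rewrite -natr1.
  have taur : tau <= r.
    have : 1 * tau <= N%:R * tau by rewrite ler_pM2r// ler1n -(ltr0n R).
    by rewrite NT; lra.
  exists (x + tau%:C *: v); split.
  - rewrite addrAC; apply: le_trans (rnormD _ _) _; rewrite jS; lra.
  - by rewrite !mxE x2 vk mulr1 jS mulrDl mul1r raddfD/= addrA.
  have h1 := H x (tau%:C *: v) ltac:(lra) ltac:(lra).
  have h2 : rnorm (vdiff x (tau%:C *: v)) <= eps * tau.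
    rewrite linearZ rnormZ rnorm_pos; last exact: ltW.
    by rewrite mulrC; apply: ler_wpM2r => //; exact: ltW.
  have h3 : K * rnorm (tau%:C *: v) ^+ 2 <= K * tau ^+ 2.
    by apply: ler_wpM2l => //; rewrite lerXn2r// nnegrE ?rnorm_ge0// ltW.
  have -> : vmap (x + tau%:C *: v) - vmap b =
    (vmap (x + tau%:C *: v) - vmap x - vdiff x (tau%:C *: v)) +
    vdiff x (tau%:C *: v) + (vmap x - vmap b).
    by rewrite subrK addrA subrK.
  apply: le_trans (rnormD _ _) _; apply: le_trans (lerD (rnormD _ _) (lexx _)) _.
  by rewrite jS; lra.
have [x [x1 x2 x3]] := P N (leqnn N).
rewrite NT in x1 x2; exists x; split => //.
apply: le_lt_trans x3 _.
have -> : N%:R * (eps * tau + K * tau ^+ 2) = eps * T + K * T ^+ 2 / N%:R.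
  by rewrite -NT; field; rewrite gt_eqF.
have h1 : eps * T = e / 4 by rewrite /eps; field; rewrite gt_eqF.
have h2 : K * T ^+ 2 / N%:R < e / 2.
  rewrite ltr_pdivrMr// in NK; rewrite ltr_pdivrMr//; have := mulr_gt0 N0 e0; clear - NK; lra.
lra.
Qed.

(** If no derivative is bounded below, then some ball consists of points with
    a common almost kernel index, and the end points of [euler_polygon]
    contradict the continuity of the left inverse. *)
Theorem nonsingular_point (U : set 'rV[C]_d) : open U -> U !=set0 ->
  (forall i x, U x -> differentiable (F i) x) ->
  (forall x k (e : R), U x -> 0 < e -> exists2 eta : R, 0 < eta & forall y, U y ->
     rnorm (vmap y - vmap x) < eta -> rnorm (y ord0 k - x ord0 k) < e) ->
  exists x (c : R), [/\ U x, 0 < c & forall h, c * rnorm h <= rnorm (vdiff x h)].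
Proof.
move=> oU [a Ua] dF inv; apply: contrapT => sing.
have [rho rho0 hrho] := openP_rball oU Ua.
have ex x : rnorm (x - a) < rho -> exists2 k, k \in enum 'I_d & almost_kernel k x.
  move=> /hrho Ux; have [|k ak] := @almost_kernel_ex x; last by exists k; rewrite ?mem_enum.
  move=> c c0; apply: contrapT => /forallNP nh; apply: sing; exists x, c; split => // h.
  by rewrite leNgt; apply/negP; exact: nh.
have [|k [b [t [t0 ht1 ht2]]]] := almost_kernel_ball rho0 _ ex.
  by move=> i y /hrho; exact: dF.
have Ub y : rnorm (y - b) < t -> U y by move=> /ht1 /hrho.
have [|T [T0 Tt HT]] := euler_polygon t0 _ ht2.
  by move=> i y /Ub; exact: dF.
have [|eta eta0 heta] := inv b k T _ T0; first by apply: Ub; rewrite subrr rnorm0.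
have [x [x1 x2 x3]] := HT eta eta0.
have := heta x (Ub x ltac:(lra)) x3.
by rewrite x2 addrAC subrr add0r rnorm_pos ?ltW// ltxx.
Qed.

End Maps.

(** * Local surjectivity *)

Section LocalSurjectivity.
Variable R : realType.
Local Notation C := (Cplx R).

Lemma bounded_below_row_free d n (L : {linear 'rV[C]_d -> 'rV[C]_n}) (c : R) :
  0 < c -> (forall h, c * rnorm h <= rnorm (L h)) -> row_free (lin1_mx L).
Proof.
move=> c0 cL; apply: inj_row_free => v; rewrite mul_rV_lin1 => Lv0.
apply: rnorm_eq0; apply/eqP; rewrite eq_le rnorm_ge0 andbT.
by have := cL v; rewrite Lv0 rnorm0 pmulr_rle0.
Qed.

Lemma bounded_below_dim d n (L : {linear 'rV[C]_d -> 'rV[C]_n}) (c : R) :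
  0 < c -> (forall h, c * rnorm h <= rnorm (L h)) -> (d <= n)%N.
Proof.
move=> c0 cL; have := bounded_below_row_free c0 cL.
by rewrite /row_free => /eqP <-; exact: rank_leq_col.
Qed.

Lemma bounded_below_surj d (L : {linear 'rV[C]_d -> 'rV[C]_d}) (c : R) :
  0 < c -> (forall h, c * rnorm h <= rnorm (L h)) -> exists A, cancel A L.
Proof.
move=> c0 cL; have := bounded_below_row_free c0 cL; rewrite row_free_unit => u.
exists (fun y => y *m invmx (lin1_mx L)) => y.
by rewrite -mul_rV_lin1 mulmxKV.
Qed.

(** Newton's iteration [u (n + 1) = u n + A (y - F (u n))] with [A] the inverse
    of the derivative at [x0]: as the derivative is Lipschitz, the error
    [y - F (u n)] is at least halved in each step as long as [u n] stays within
    [s] of [x0], and the steps are small enough to ensure that. *)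
Theorem local_surjectivity d (F : 'I_d -> 'rV[C]_d -> C) (x0 : 'rV[C]_d) (rho c : R) :
  0 < rho -> (forall i y, rnorm (y - x0) < rho -> differentiable (F i) y) ->
  0 < c -> (forall h, c * rnorm h <= rnorm (vdiff F x0 h)) ->
  exists2 delta : R, 0 < delta & forall y, rnorm (y - vmap F x0) < delta ->
    exists2 x, rnorm (x - x0) < rho & vmap F x = y.
Proof.
move=> rho0 dF c0 cL; have [A AL] := bounded_below_surj c0 cL.
have cA y : rnorm (A y) <= rnorm y / c.
  by rewrite ler_pdivlMr// mulrC -[in leRHS](AL y); exact: cL.
have [r [K [r0 K0 H lip]]] := local_C2_map rho0 dF.
pose s := Num.min (Num.min r rho / 3) (c / (4 * (K + 1))).
have K1 : 0 < 4 * (K + 1) by lra.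
have s0 : 0 < s by rewrite !lt_min divr_gt0// ?lt_min ?r0// divr_gt0.
have [sr srho sK] : [/\ 3 * s <= r, 3 * s <= rho & s <= c / (4 * (K + 1))].
  have h1 : s <= Num.min r rho / 3 by rewrite /s ge_min lexx.
  have h2 : Num.min r rho <= r by rewrite ge_min lexx.
  have h3 : Num.min r rho <= rho by rewrite ge_min lexx orbT.
  by split; [lra|lra|rewrite /s ge_min lexx orbT].
clearbody s.
rewrite ler_pdivlMr// in sK.
pose delta := c * s / 2.
have delta0 : 0 < delta by rewrite /delta divr_gt0// mulr_gt0.
exists delta => // y yx.
pose u := fix u n := if n is m.+1 then u m + A (y - vmap F (u m)) else x0.
pose q n : R := 2^-1 ^+ n.
have q0 n : 0 < q n by rewrite exprn_gt0// invr_gt0.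
have q1 n : q n <= 1 by rewrite exprn_ile1 ?invr_ge0// invf_le1// ler1n.
have qS n : q n.+1 = q n / 2 by rewrite /q exprS mulrC.
have dc : delta / c = s / 2 by rewrite /delta; field; rewrite gt_eqF.
have Ae n : rnorm (y - vmap F (u n)) <= delta * q n ->
    rnorm (A (y - vmap F (u n))) <= s / 2 * q n.
  move=> h; apply: le_trans (cA _) _; rewrite -dc mulrAC.
  by rewrite ler_pM2r ?invr_gt0.
have inv n : rnorm (u n - x0) <= s * (1 - q n) /\
             rnorm (y - vmap F (u n)) <= delta * q n.
  elim: n => [|n [IH1 IH2]].
    by rewrite /q expr0 !subrr rnorm0 !mulr0 mulr1; split => //; exact: ltW.
  have a1 := Ae n IH2; have q0n := q0 n; have q1n := q1 n.
  have sq : 0 < s * q n by rewrite mulr_gt0.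
  split.
    rewrite /= addrAC; apply: le_trans (rnormD _ _) _; rewrite qS; clear - IH1 a1 sq; lra.
  set h := A (y - vmap F (u n)) in a1 *.
  have hs : rnorm h <= s.
    have : s * q n <= s * 1 by rewrite ler_pM2l.
    by clear - a1 sq; lra.
  have us : rnorm (u n - x0) <= s by lra.
  have b1 := H (u n) h ltac:(lra) ltac:(lra).
  have b2 := lip x0 (u n) h ltac:(by rewrite subrr rnorm0) ltac:(lra).
  (* The new error is the second-order remainder at [u n] plus the defect of the
     derivative at [u n] from that at [x0], where [A] is an exact inverse. *)
  have E : y - vmap F (u n.+1) =
     - (vmap F (u n + h) - vmap F (u n) - vdiff F (u n) h) -
     (vdiff F (u n) h - vdiff F x0 h).
    rewrite [vdiff F x0 h]AL /=; rewrite -/h.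
    move: (vmap F (u n + h)) (vmap F (u n)) (vdiff F (u n) h) => a b e.
    by apply/rowP => i; rewrite !mxE; ring.
  rewrite E; apply: le_trans (rnormB _ _) _; rewrite rnormN.
  have hp := rnorm_ge0 h; have up := rnorm_ge0 (u n - x0).
  have b3 : K * rnorm h ^+ 2 <= K * s * rnorm h.
    by rewrite expr2 mulrA; apply: ler_wpM2r => //; apply: ler_wpM2l.
  have b4 : K * rnorm (u n - x0) * rnorm h <= K * s * rnorm h.
    by apply: ler_wpM2r => //; apply: ler_wpM2l.
  have b5 : 2 * (K * s) <= c / 2 by clear - sK s0; lra.
  have b6 : 2 * (K * s) * rnorm h <= c / 2 * rnorm h by apply: ler_wpM2r.
  have b7 : c / 2 * rnorm h <= c / 2 * (s / 2 * q n) by apply: ler_wpM2l => //; rewrite divr_ge0// ltW.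
  apply: le_trans (lerD b1 b2) _; rewrite qS /delta; clear - b3 b4 b6 b7; lra.
have [x hx] : exists l, forall n, rnorm (u n - l) <= 4 * (s / 2) * q n.
  apply: geom_complete_row => n; rewrite [u n.+1]/=.
  rewrite addrAC subrr add0r; apply: Ae; exact: (inv n).2.
have xx0 : rnorm (x - x0) <= 2 * s.
  by have := hx 0%N; rewrite /q expr0 mulr1 /= rdistC; lra.
exists x; first by lra.
apply/eqP; rewrite -subr_eq0; apply/eqP/rnorm_eq0/eqP.
rewrite eq_le rnorm_ge0 andbT; apply/ler_addgt0Pr => e e0; rewrite add0r.
have cF i : {for x, continuous (F i)}.
  by apply: differentiable_continuous; apply: dF; lra.
apply: rnorm_row_le; first exact: ltW.
move=> i; rewrite !mxE.
have /continuous_rnormP/(_ (e / 2) ltac:(lra))[d' d'0 hd'] := cF i.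
have [n1 hn1] := geom_lt (4 * (s / 2)) d'0.
have [n2 hn2] := @geom_lt R delta (e / 2) ltac:(lra).
have le_q m1 m2 : (m1 <= m2)%N -> q m2 <= q m1.
  by move=> m12; rewrite /q; apply: ler_wiXn2l => //; rewrite ?invr_ge0// invf_le1// ler1n.
pose m := maxn n1 n2.
have m1 : rnorm (u m - x) < d'.
  apply: le_lt_trans (hx m) _; apply: le_lt_trans hn1; apply: ler_wpM2l; first by lra.
  exact: le_q (leq_maxl _ _).
have m2 : rnorm (y - vmap F (u m)) < e / 2.
  apply: le_lt_trans (inv m).2 _; apply: le_lt_trans hn2; apply: ler_wpM2l; first exact: ltW.
  exact: le_q (leq_maxr _ _).
have m3 := hd' _ m1.
have m4 : rnorm (y ord0 i - F i (u m)) < e / 2.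
  by apply: le_lt_trans m2; apply: le_trans (rnorm_coord _ i); rewrite !mxE.
have := rdist_triangle (F i (u m)) (y ord0 i) (F i x); rewrite rdistC.
by clear - m3 m4; lra.
Qed.

End LocalSurjectivity.

(** * Bounded bijections have bounded inverses *)

Section BoundedInverse.
Variable R : realType.
Local Notation C := (Cplx R).
Variables (V W : completeNormedModType C) (T : V -> W) (N : W -> V).
Hypotheses (Tlin : linear T) (Tbd : bounded_map T).
Hypotheses (TN : cancel T N) (NT : cancel N T).

Lemma inverse_linear : linear N.
Proof. by move=> a u v; apply: (can_inj TN); rewrite Tlin !NT. Qed.

Let TB x y : T (x - y) = T x - T y.
Proof. by rewrite -scaleN1r addrC Tlin scaleN1r addrC. Qed.
Let NB x y : N (x - y) = N x - N y.
Proof. by rewrite -scaleN1r addrC inverse_linear scaleN1r addrC. Qed.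
Let N0 : N 0 = 0.
Proof. by rewrite -(subrr 0) NB subrr. Qed.
Let NZ a x : N (a *: x) = a *: N x.
Proof. by have := inverse_linear a x 0; rewrite !addr0 N0 addr0. Qed.

(** The category argument: otherwise there are nested balls, the [n]-th one
    consisting of points [w] with [|N w| > n], which can have no common point. *)
Lemma inverse_dense_ball : exists n a (r : R), 0 < r /\ forall w : W, rnorm (w - a) < r ->
  forall e : R, 0 < e -> exists w', rnorm (w' - w) < e /\ rnorm (N w') <= n.
Proof.
apply: contrapT => /forallNP no.
have step : forall st : nat * (W * R), exists ar : W * R, 0 < st.2.2 ->
   [/\ 0 < ar.2, ar.2 <= st.2.2 / 2, rnorm (ar.1 - st.2.1) + ar.2 <= st.2.2 &
    forall w, rnorm (w - ar.1) <= ar.2 -> st.1%:R < rnorm (N w)].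
  move=> [n [a r]] /=; have [r0|] := pselect (0 < r); last by exists (0, 0).
  have : exists w, rnorm (w - a) < r /\
      exists2 e : R, 0 < e & forall w', rnorm (w' - w) < e -> n%:R < rnorm (N w').
    apply: contrapT => /forallNP H; apply: (no n%:R); exists a, r; split => // w wa e e0.
    apply: contrapT => /forallNP H'; apply: (H w); split => //; exists e => // w' ww'.
    rewrite ltNge; apply/negP => Nw; exact: (H' w').
  move=> [w [wa [e e0 he]]].
  pose s := Num.min (e / 2) (Num.min (r / 2) (r - rnorm (w - a))).
  have s0 : 0 < s by rewrite !lt_min !divr_gt0// subr_gt0.
  have [s1 s2 s3] : [/\ s <= e / 2, s <= r / 2 & s <= r - rnorm (w - a)].
    by split; rewrite /s !ge_min lexx ?orbT.
  clearbody s; exists (w, s) => _; split => //=; first by lra.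
  by move=> w' ww'; apply: he; lra.
have [F HF] := choice step.
pose g := fix g n := if n is m.+1 then F (m, g m) else (0 : W, 1 : R).
have gp n : 0 < (g n).2 by elim: n => [|n IH] //; have [] := HF (n, g n) IH.
have gS n := HF (n, g n) (gp n).
have g2 n : (g n).2 <= 2^-1 ^+ n.
  elim: n => [|n IH]; first by rewrite expr0.
  by have [_ h _ _] := gS n; apply: le_trans h _; rewrite exprS /=; lra.
have nest n k : rnorm ((g (n + k)%N).1 - (g n).1) + (g (n + k)%N).2 <= (g n).2.
  elim: k => [|k IH]; first by rewrite addn0 subrr rnorm0 add0r.
  rewrite addnS; have [_ _ h _] := gS (n + k)%N.
  have := rdist_triangle (g (n + k)%N).1 (g (n + k).+1).1 (g n).1.
  by move: h => /=; lra.
have [l hl] : exists l, forall n, rnorm ((g n).1 - l) <= 2 * 1 * 2^-1 ^+ n.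
  apply: geom_complete_Banach => n; have [_ _ h _] := gS n.
  by have := g2 n; have := gp n.+1; move: h => /=; lra.
have lg n : rnorm (l - (g n).1) <= (g n).2.
  apply: (@le_geom R 2) => k.
  have h1 := nest n k; have h2 := hl (n + k)%N; rewrite mulr1 exprD in h2.
  have h3 := rdist_triangle (g (n + k)%N).1 l (g n).1; rewrite (rdistC l (g (n + k)%N).1) in h3.
  have h4 := gp (n + k)%N.
  have h5 : 2 * (2^-1 ^+ n * 2^-1 ^+ k) <= 2 * 2^-1 ^+ k :> R.
    rewrite ler_pM2l// ler_piMl ?exprn_ge0 ?invr_ge0//.
    by rewrite exprn_ile1 ?invr_ge0// invf_le1// ler1n.
  by lra.
pose n := (Num.truncn (rnorm (N l))).+1.
have : rnorm (N l) < n%:R by exact: truncnS_gt.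
have [_ _ _ /(_ l (lg n.+1))] := gS n.
by move=> h1 h2; have := lt_trans h1 h2; rewrite ltxx.
Qed.

(** Differences of points of the ball of [inverse_dense_ball] approximate all
    small vectors, and homogeneity transports this to every scale. *)
Lemma inverse_approx : exists M r : R, [/\ 0 <= M, 0 < r & forall (k : nat) (h : W),
  rnorm h < r * 2^-1 ^+ k -> exists u, rnorm (h - u) < r * 2^-1 ^+ k.+1 /\
    rnorm (N u) <= M * 2^-1 ^+ k].
Proof.
have [n [a [r [r0 H]]]] := inverse_dense_ball.
have n0 : 0 <= n.
  have [w' [_]] := H a ltac:(by rewrite subrr rnorm0) 1 ltr01.
  by apply: le_trans; exact: rnorm_ge0.
have A h (e : R) : rnorm h < r -> 0 < e -> exists u, rnorm (h - u) < e /\ rnorm (N u) <= 2 * n.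
  move=> hr e0.
  have [w1 [a1 b1]] := H (a + h) ltac:(by rewrite addrAC subrr add0r) (e / 2) ltac:(lra).
  have [w2 [a2 b2]] := H a ltac:(by rewrite subrr rnorm0) (e / 2) ltac:(lra).
  exists (w1 - w2); split.
    have -> : h - (w1 - w2) = (w2 - a) - (w1 - (a + h)).
      by rewrite !opprB [RHS]addrA subrKA addrA [h + _]addrC.
    apply: le_lt_trans (rnormB _ _) _; lra.
  by rewrite NB; apply: le_trans (rnormB _ _) _; lra.
exists (2 * n), r; split => //; first by lra.
move=> k h hk; pose q : R := 2^-1 ^+ k.
have q0 : 0 < q by rewrite exprn_gt0// invr_gt0.
have qC0 : (q%:C : C) != 0 by apply: rnorm_neq0; rewrite rnorm_pos// ltW.
have [||u [u1 u2]] := A ((q%:C)^-1 *: h) (r / 2).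
- by rewrite rnormZ rnormV rnorm_pos ?ltW// mulrC ltr_pdivrMr.
- by lra.
exists (q%:C *: u); split.
  have -> : h - q%:C *: u = q%:C *: ((q%:C)^-1 *: h - u).
    by rewrite scalerBr scalerA divff// scale1r.
  rewrite rnormZ rnorm_pos ?ltW// exprS -/q.
  have : q * rnorm ((q%:C)^-1 *: h - u) < q * (r / 2) by rewrite ltr_pM2l.
  lra.
have qw := ltW q0; rewrite NZ rnormZ rnorm_pos// [leLHS]mulrC -/q.
exact: ler_wpM2r.
Qed.

(** Successive approximation writes a small [h] as a sum of vectors [u n] with
    [|N (u n)| <= M / 2 ^ n]; the series of the [N (u n)] converges by
    completeness of [V], and its sum is [N h] because [T] is continuous. *)
Theorem bounded_inverse : bounded_map N.
Proof.
have [B TBd] := (bounded_mapP T).1 Tbd.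
have [M [r [M0 r0 H]]] := inverse_approx.
suff ball h : rnorm h < r -> rnorm (N h) <= 2 * M.
  apply/bounded_mapP; exists (4 * M / r) => h.
  have [->|h0] := eqVneq h 0; first by rewrite N0 !rnorm0 mulr0.
  have hp := rnorm_gt0 h0.
  pose c := r / (2 * rnorm h).
  have c0 : 0 < c by rewrite divr_gt0// mulr_gt0.
  have ch : c * rnorm h = r / 2 by rewrite /c; field; rewrite gt_eqF.
  have cw := ltW c0.
  have := ball (c%:C *: h); rewrite NZ !rnormZ rnorm_pos// ch => /(_ ltac:(lra)).
  rewrite -ler_pdivlMl// => /le_trans; apply.
  rewrite le_eqVlt; apply/orP; left; apply/eqP.
  by rewrite /c; field; rewrite !gt_eqF.
move=> hr.
have step : forall kh : nat * W, exists u, rnorm kh.2 < r * 2^-1 ^+ kh.1 ->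
   rnorm (kh.2 - u) < r * 2^-1 ^+ kh.1.+1 /\ rnorm (N u) <= M * 2^-1 ^+ kh.1.
  move=> [k h'] /=; have [/H[u hu]|] := pselect (rnorm h' < r * 2^-1 ^+ k); first by exists u.
  by exists 0.
have [F HF] := choice step.
pose g := fix g n := if n is m.+1 then g m - F (m, g m) else h.
have gr n : rnorm (g n) < r * 2^-1 ^+ n.
  elim: n => [|n IH]; first by rewrite expr0 mulr1.
  by have [] := HF (n, g n) IH.
pose v n := N (h - g n).
have [l hl] : exists l, forall n, rnorm (v n - l) <= 2 * M * 2^-1 ^+ n.
  apply: geom_complete_Banach => n; rewrite /v -NB.
  have [_ hn] := HF (n, g n) (gr n); apply: le_trans hn.
  have E (a b c : W) : a - (b - c) - (a - b) = c.
    by rewrite !opprB [a + _]addrC -!addrA (addrCA a) subrr addr0 addNr addr0.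
  by rewrite [g n.+1]/= E.
have -> : N h = l.
  suff -> : h = T l by rewrite TN.
  apply/eqP; rewrite -subr_eq0; apply/eqP/rnorm_eq0/eqP.
  rewrite eq_le rnorm_ge0 andbT; apply: (@le_geom R (r + `|B| * (2 * M))) => n.
  have -> : h - T l = g n + T (v n - l) by rewrite TB NT addrA [g n + _]addrC subrK.
  apply: le_trans (rnormD _ _) _; rewrite add0r mulrDl.
  apply: lerD; first exact: ltW.
  apply: le_trans (TBd _) _; rewrite -mulrA.
  apply: le_trans (ler_wpM2r (rnorm_ge0 _) (ler_norm B)) _.
  by apply: ler_wpM2l.
by have := hl 0%N; rewrite /v /= subrr N0 sub0r rnormN expr0 mulr1.
Qed.

End BoundedInverse.

(** * Functions on a subset of a normed space *)

Section Subtypes.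
Variable R : realType.
Local Notation C := (Cplx R).

Lemma valL_set_val (U V : Type) (A : set U) (v : V) (f : A -> V) (x : A) :
  valL_ v f (set_val x) = f x.
Proof. exact: (congr1 (fun h => h x) (valLK v f)). Qed.

Lemma valL_out (U V : Type) (A : set U) (v : V) (f : A -> V) (u : U) :
  ~ A u -> valL_ v f u = v.
Proof. by move=> Au; rewrite /valL_ /= oinv_set_val insubN//; apply: contra_notN Au; rewrite inE. Qed.

Lemma set_val_ex (U : Type) (A : set U) (u : U) : A u -> exists x : A, set_val x = u.
Proof. by move=> Au; exists (SigSub (mem_set Au)). Qed.

Lemma set_val_inj (U : Type) (A : set U) : injective (set_val : A -> U).
Proof. exact: val_inj. Qed.

Section continuity.
Variables (V W : normedModType C) (X : set V).

Lemma subtype_nbhs (x : X) (B : set V) : nbhs (set_val x) B ->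
  nbhs x [set y : X | B (set_val y)].
Proof. by move=> xB; exact: (@initial_continuous _ _ set_val x). Qed.

Lemma subtype_continuousP (f : X -> W) (x : X) :
  {for x, continuous f} <->
  forall e : R, 0 < e -> exists2 d : R, 0 < d &
    forall y : X, rnorm (set_val y - set_val x) < d -> rnorm (f y - f x) < e.
Proof.
split=> [fc e e0|H A /nbhs_rballP[e e0 eA]].
  have : nbhs x (f @^-1` [set w | rnorm (w - f x) < e]).
    by apply: fc; apply/nbhs_rballP; exists e.
  rewrite nbhsE => -[B [[D oD DB] Bx] BA].
  have Dx : D (set_val x) by move: Bx; rewrite -DB.
  have [d d0 hd] := openP_rball oD Dx.
  by exists d => // y yx; apply: BA; rewrite -DB; exact: hd.
have [d d0 hd] := H e e0.
have : nbhs x [set y : X | rnorm (set_val y - set_val x) < d].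
  by apply: (@subtype_nbhs x [set y | rnorm (y - set_val x) < d]); apply/nbhs_rballP; exists d.
by apply: filterS => y /= /hd; exact: eA.
Qed.

Lemma continuous_to_subtype (T : topologicalType) (g : T -> X) :
  continuous (fun t => set_val (g t)) -> continuous g.
Proof.
move=> gc t A; rewrite nbhsE => -[B [[D oD DB] Bx] BA].
have Dx : D (set_val (g t)) by move: Bx; rewrite -DB.
have : nbhs t [set s | D (set_val (g s))] by apply: gc; exact: open_nbhs_nbhs.
by apply: filterS => s Ds; apply: BA; rewrite -DB.
Qed.

End continuity.

End Subtypes.

(** * Relations between products in a Hilbert function space *)

Section UniquenessSets.
Variable R : realType.
Local Notation C := (Cplx R).
Variables (V : normedModType C) (X : set V) (H : hilbertFunctionSpace R X).
Hypotheses (Xconn : connected X°) (Xdense : X `<=` closure X°).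
Hypothesis Hhol : forall (f : H) z, X° z -> differentiable (valL_ 0 (hfs_fun f)) z.
Hypothesis Hcont : forall f : H, continuous (hfs_fun f).

(** The products need not belong to [H], but they are holomorphic inside and
    continuous on [X], which is all that the identity theorem and the density
    of the interior use. *)
Lemma product_identity (f g h k : H) (y0 : V) (e : R) : 0 < e ->
  (forall y, rnorm (y - y0) < e -> X y) ->
  (forall y : X, rnorm (set_val y - y0) < e ->
     hfs_fun f y * hfs_fun g y = hfs_fun h y * hfs_fun k y) ->
  forall y : X, hfs_fun f y * hfs_fun g y = hfs_fun h y * hfs_fun k y.
Proof.
move=> e0 ball E.
pose v (f : H) := valL_ 0 (hfs_fun f).
pose D z := v f z * v g z - v h z * v k z.
have vE (f' : H) (y : X) : v f' (set_val y) = hfs_fun f' y by exact: valL_set_val.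
have oX : open X° by exact: open_interior.
have Xy0 : X° y0 by apply/nbhs_rballP; exists e.
have D0 : forall z, X° z -> D z = 0.
  apply: (identity_theorem oX Xconn _ e0 Xy0).
    move=> z Xz.
    have dp f' g' : differentiable (v f' * v g') z.
      by apply: differentiableM; exact: Hhol.
    exact: (differentiableB (dp f g) (dp h k)).
  move=> z zy; have [y yz] := set_val_ex (ball z zy).
  by rewrite -yz in zy *; rewrite /D !vE (E y zy) subrr.
move=> y; apply/eqP; rewrite -subr_eq0; apply/eqP/rnorm_eq0/eqP.
rewrite eq_le rnorm_ge0 andbT; apply/ler_addgt0Pr => r r0; rewrite add0r.
pose G (y : X) := hfs_fun f y * hfs_fun g y - hfs_fun h y * hfs_fun k y.
have cG : {for y, continuous G}.
  exact: (continuousB (continuousM (@Hcont f y) (@Hcont g y)) (continuousM (@Hcont h y) (@Hcont k y))).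
have [d d0 hd] := (subtype_continuousP _ _).1 cG r r0.
have [] := Xdense (set_valP y) (B := [set z | rnorm (z - set_val y) < d]).
  by apply/nbhs_rballP; exists d.
move=> z [Xz zy]; have [u uz] := set_val_ex (interior_subset Xz).
rewrite -uz in Xz zy; have := hd u zy.
have -> : G u = 0 by rewrite -(D0 _ Xz) /D !vE.
by rewrite sub0r rnormN => /ltW.
Qed.

End UniquenessSets.

(** * Weighted composition operators *)

Section Polynomials.
Import (canonicals) mpoly.
Variables (R : realType) (d : nat) (X : set 'rV[Cplx R]_d).
Local Notation C := (Cplx R).

Lemma poly_fun1 : poly_fun (mpoly.mpolyC d (1 : C)) = (fun=> 1) :> (X -> C).
Proof. by apply/funext => x; rewrite /poly_fun mpoly.mevalC. Qed.

Lemma poly_funX i : poly_fun (mpoly.mpolyX C (mpoly.mnm1 i)) = coord_fun i :> (X -> C).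
Proof. by apply/funext => x; rewrite /poly_fun mpoly.mevalXU. Qed.

Lemma poly_fun_sqr (p : mpoly.mpoly d C) : exists q : mpoly.mpoly d C,
  forall x : X, poly_fun q x = poly_fun p x * poly_fun p x.
Proof. by exists (p * p) => x; rewrite /poly_fun mpoly.mevalM. Qed.

End Polynomials.

Section WeightedComposition.
Variables (R : realType) (d1 d2 : nat).
Local Notation C := (Cplx R).
Variables (X1 : set 'rV[C]_d1) (X2 : set 'rV[C]_d2).
Variables (H1 : hilbertFunctionSpace R X1) (H2 : hilbertFunctionSpace R X2).
Variables (lambda : X1 -> C) (phi : X1 -> X2) (W : H2 -> H1) (N : H1 -> H2).
Hypothesis W_wco : weighted_composition_operator lambda phi W.
Hypotheses (WN : cancel W N) (NW : cancel N W).
Hypothesis H1_polynomials : forall p : mpoly.mpoly d1 C,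
  exists f : H1, hfs_fun f = poly_fun p.

Let WE (f : H2) (x : X1) : hfs_fun (W f) x = lambda x * hfs_fun f (phi x).
Proof. by have [_ _] := W_wco; apply. Qed.

Lemma inverse_wcoE (g : H1) (x : X1) : lambda x * hfs_fun (N g) (phi x) = hfs_fun g x.
Proof. by rewrite -WE NW. Qed.

Lemma constant_one_mem : exists p : H1, hfs_fun p = fun=> 1.
Proof. by have [p ph] := H1_polynomials (mpoly.mpolyC d1 (1 : C)); exists p; rewrite ph poly_fun1. Qed.

Lemma coordinate_mem i : exists p : H1, hfs_fun p = coord_fun i.
Proof.
by have [p ph] := H1_polynomials (mpoly.mpolyX C (mpoly.mnm1 i)); exists p; rewrite ph poly_funX.
Qed.

(** [f0] extends [1 / (lambda o phi^-1)] from the image of [phi] to [X2]. *)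
Lemma weight_reciprocal : exists f0 : H2, forall x, lambda x * hfs_fun f0 (phi x) = 1.
Proof. by have [p ph] := constant_one_mem; exists (N p) => x; rewrite inverse_wcoE ph. Qed.

Lemma weight_neq0 x : lambda x != 0.
Proof.
have [f0 h] := weight_reciprocal; apply/eqP => l0.
by have := h x; rewrite l0 mul0r => /eqP; rewrite eq_sym oner_eq0.
Qed.

(** Both sides are [h / lambda ^ 2] evaluated at [x]. *)
Lemma inverse_wco_products (f g h : H1) : (forall x, hfs_fun h x = hfs_fun f x * hfs_fun g x) ->
  forall f0 : H2, (forall x, lambda x * hfs_fun f0 (phi x) = 1) ->
  forall x, hfs_fun (N f) (phi x) * hfs_fun (N g) (phi x) =
            hfs_fun (N h) (phi x) * hfs_fun f0 (phi x).
Proof.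
move=> hE f0 f0E x; apply: (mulfI (weight_neq0 x)); apply: (mulfI (weight_neq0 x)).
have -> : lambda x * (lambda x * (hfs_fun (N f) (phi x) * hfs_fun (N g) (phi x))) =
  (lambda x * hfs_fun (N f) (phi x)) * (lambda x * hfs_fun (N g) (phi x)) by ring.
have -> : lambda x * (lambda x * (hfs_fun (N h) (phi x) * hfs_fun f0 (phi x))) =
  (lambda x * hfs_fun (N h) (phi x)) * (lambda x * hfs_fun f0 (phi x)) by ring.
by rewrite !inverse_wcoE f0E mulr1 hE.
Qed.

Lemma left_inverse_coord k : exists f0 fk : H2, forall x,
  hfs_fun f0 (phi x) != 0 /\
  hfs_fun fk (phi x) * (hfs_fun f0 (phi x))^-1 = set_val x ord0 k.
Proof.
have [f0 f0E] := weight_reciprocal; have [p ph] := coordinate_mem k.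
exists f0, (N p) => x; have l0 := weight_neq0 x.
have f00 : hfs_fun f0 (phi x) != 0.
  by apply/eqP => z; have := f0E x; rewrite z mulr0 => /eqP; rewrite eq_sym oner_eq0.
split => //; apply: (mulIf f00); rewrite divfK//.
apply: (mulfI l0); rewrite inverse_wcoE ph mulrCA f0E mulr1 //.
Qed.

(** The constants and coordinate functions of [H1] separate the points of [X1],
    and the inverse coordinates depend on [phi x] only. *)
Lemma phi_inj : injective phi.
Proof.
move=> x y xy; apply: set_val_inj; apply/rowP => k.
have [f0 [fk h]] := left_inverse_coord k.
by rewrite -(h x).2 -(h y).2 xy.
Qed.

Section regularity.
Hypothesis H1_hol : forall f : H1, holomorphic_on_interior (hfs_fun f).
Hypothesis H1_cont : forall f : H1, continuous (hfs_fun f).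
Hypothesis H2_cont : forall f : H2, continuous (hfs_fun f).
Hypothesis H2_constants : forall c : C, exists f : H2, hfs_fun f = fun=> c.
Hypothesis H2_coordinates : forall i : 'I_d2, exists f : H2, hfs_fun f = coord_fun i.

Lemma weighted_phi_mem : exists (L : H1) (P : 'I_d2 -> H1), forall x,
  hfs_fun L x = lambda x /\ forall i, hfs_fun (P i) x = lambda x * set_val (phi x) ord0 i.
Proof.
have [e eE] := H2_constants 1; have [c cE] := choice H2_coordinates.
exists (W e), (fun i => W (c i)) => x; rewrite WE eE mulr1; split => // i.
by rewrite WE cE.
Qed.

(** Extending by [0] outside [X1] commutes with the quotients, as [0 / 0 = 0];
    so the extension of [phi] is globally a map with quotient components. *)
Lemma phi_components : exists F : 'I_d2 -> 'rV[C]_d1 -> C,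
  [/\ forall i z, X1° z -> differentiable (F i) z,
      forall x, set_val (phi x) = vmap F (set_val x) &
      valL_ 0 (fun x => set_val (phi x)) = vmap F].
Proof.
have [L [P LP]] := weighted_phi_mem.
pose F i z := valL_ 0 (hfs_fun (P i)) z * (valL_ 0 (hfs_fun L) z)^-1.
have FE x : set_val (phi x) = vmap F (set_val x).
  apply/rowP => i; rewrite mxE /F !valL_set_val; have [-> ->] := LP x.
  by rewrite mulrAC divff ?mul1r// weight_neq0.
exists F; split; [|exact: FE|].
  move=> i z Xz; apply: differentiableM; first exact: H1_hol.
  apply: differentiableV; first exact: H1_hol.
  have [x <-] := set_val_ex (interior_subset Xz).
  by rewrite valL_set_val (LP x).1 weight_neq0.
apply/funext => z; have [Xz|Xz] := pselect (X1 z).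
  by have [x <-] := set_val_ex Xz; rewrite valL_set_val.
by rewrite valL_out//; apply/rowP => i; rewrite !mxE /F !valL_out// mul0r.
Qed.

Lemma phi_holomorphic : holomorphic_on_interior (fun x => set_val (phi x)).
Proof.
have [F [dF _ E]] := phi_components; move=> z Xz; rewrite E.
have -> : vmap F = \sum_i (fun z => F i z *: (delta_mx ord0 i : 'rV[C]_d2)).
  apply/funext => y; rewrite fct_sumE; apply/rowP => j.
  rewrite summxE (bigD1 j)//= !mxE !eqxx mulr1 big1 ?addr0// => i ij.
  by rewrite !mxE eqxx eq_sym (negbTE ij) mulr0.
by apply: differentiable_sum => i; apply: differentiableZl; exact: dF.
Qed.

Lemma phi_continuous : continuous phi.
Proof.
have [L [P LP]] := weighted_phi_mem.
apply: continuous_to_subtype => x; apply/subtype_continuousP => e e0.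
have cq i : {for x, continuous (fun x => hfs_fun (P i) x * (hfs_fun L x)^-1)}.
  apply: (continuousM (@H1_cont (P i) x)).
  by apply: continuousV (@H1_cont L x); rewrite (LP x).1 weight_neq0.
have qE i y : hfs_fun (P i) y * (hfs_fun L y)^-1 = set_val (phi y) ord0 i.
  by have [-> ->] := LP y; rewrite mulrAC divff ?mul1r// weight_neq0.
have H i : exists d : R, 0 < d /\ forall y : X1, rnorm (set_val y - set_val x) < d ->
    rnorm (set_val (phi y) ord0 i - set_val (phi x) ord0 i) < e.
  have [d d0 hd] := (subtype_continuousP _ _).1 (cq i) e e0.
  by exists d; split => // y /hd; rewrite !qE.
have [d hd] := choice H.
have d0 i : 0 < d i by have [] := hd i.
pose S := 1 + \sum_i (d i)^-1.
have S0 : 0 < S by rewrite ltr_pwDl// sumr_ge0// => i _; rewrite invr_ge0 ltW.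
exists S^-1; first by rewrite invr_gt0.
move=> y yx; apply/rnorm_row_lt => // i; rewrite !mxE; apply: (hd i).2.
apply: lt_le_trans yx _.
rewrite invf_ple ?posrE//; apply: le_trans (le_sum_nneg (f := fun i => (d i)^-1) i _) _.
  by move=> j; rewrite invr_ge0 ltW.
by rewrite /S lerDr.
Qed.

Lemma left_inverse_continuous F : (forall x, set_val (phi x) = vmap F (set_val x)) ->
  forall x k (e : R), X1° x -> 0 < e -> exists2 eta : R, 0 < eta & forall y, X1° y ->
     rnorm (vmap F y - vmap F x) < eta -> rnorm (y ord0 k - x ord0 k) < e.
Proof.
move=> FE z k e Xz e0; have [x xz] := set_val_ex (interior_subset Xz).
have [f0 [fk h]] := left_inverse_coord k.
have cq : {for phi x, continuous (fun y => hfs_fun fk y * (hfs_fun f0 y)^-1)}.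
  apply: (continuousM (@H2_cont fk (phi x))).
  by apply: continuousV (@H2_cont f0 (phi x)); exact: (h x).1.
have [d d0 hd] := (subtype_continuousP _ _).1 cq e e0.
exists d => // w Xw; have [y yw] := set_val_ex (interior_subset Xw).
rewrite -xz -yw -!FE => /hd.
by rewrite (h x).2 (h y).2.
Qed.

Lemma phi_nonsingular : X1° !=set0 -> exists F z (c : R),
  [/\ forall i z, X1° z -> differentiable (F i) z,
      forall x, set_val (phi x) = vmap F (set_val x),
      X1° z, 0 < c & forall h, c * rnorm h <= rnorm (vdiff F z h)].
Proof.
move=> X1ne; have [F [dF FE _]] := phi_components.
have [z [c [Xz c0 hc]]] := nonsingular_point (@open_interior _ X1) X1ne dF (left_inverse_continuous FE).
by exists F, z, c.
Qed.

End regularity.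

End WeightedComposition.

(** * Surjectivity of the composition map *)

Section Surjectivity.
Variables (R : realType) (d : nat).
Local Notation C := (Cplx R).
Variables (X1 X2 : set 'rV[C]_d).
Variables (H1 : hilbertFunctionSpace R X1) (H2 : hilbertFunctionSpace R X2).
Variables (lambda : X1 -> C) (phi : X1 -> X2) (W : H2 -> H1) (N : H1 -> H2).
Hypothesis W_wco : weighted_composition_operator lambda phi W.
Hypotheses (WN : cancel W N) (NW : cancel N W).
Hypothesis H1_polynomials : forall p : mpoly.mpoly d C,
  exists f : H1, hfs_fun f = poly_fun p.
Hypothesis X1_int : X1° !=set0.
Hypothesis H1_hol : forall f : H1, holomorphic_on_interior (hfs_fun f).
Hypothesis H2_hol : forall f : H2, holomorphic_on_interior (hfs_fun f).
Hypothesis H2_cont : forall f : H2, continuous (hfs_fun f).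
Hypothesis H2_constants : forall c : C, exists f : H2, hfs_fun f = fun=> c.
Hypothesis H2_coordinates : forall i : 'I_d, exists f : H2, hfs_fun f = coord_fun i.
Hypothesis X2_conn : connected X2°.
Hypothesis X2_dense : X2 `<=` closure X2°.
Hypothesis H1_dense : dense [set f : H1 | exists p : mpoly.mpoly d C, hfs_fun f = poly_fun p].
Hypothesis H1_max : maximal_domain H1.

Lemma range_has_ball : exists (y0 : 'rV[C]_d) (e : R), 0 < e /\
  forall y, rnorm (y - y0) < e -> exists x, set_val (phi x) = y.
Proof.
have [F [z [c [dF FE Xz c0 hc]]]] :=
  phi_nonsingular W_wco NW H1_polynomials H1_hol H2_cont H2_constants H2_coordinates X1_int.
have [rho rho0 hrho] := openP_rball (@open_interior _ X1) Xz.
have [|delta delta0 hd] := @local_surjectivity R d F z rho c rho0 _ c0 hc.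
  by move=> i y /hrho; exact: dF.
exists (vmap F z), delta; split => // y /hd[x xz <-].
have [x' x'x] := set_val_ex (interior_subset (hrho x xz)).
by exists x'; rewrite FE x'x.
Qed.

Lemma product_identity_range (f g h k : H2) :
  (forall x, hfs_fun f (phi x) * hfs_fun g (phi x) =
             hfs_fun h (phi x) * hfs_fun k (phi x)) ->
  forall y, hfs_fun f y * hfs_fun g y = hfs_fun h y * hfs_fun k y.
Proof.
move=> E; have [y0 [e [e0 he]]] := range_has_ball.
apply: (product_identity X2_conn X2_dense H2_hol H2_cont e0).
  by move=> y /he[x <-]; exact: set_valP.
by move=> y /he[x /set_val_inj <-]; exact: E.
Qed.

Let N_linear : linear N.
Proof. by have [Wl _ _] := W_wco; exact: (inverse_linear Wl WN NW). Qed.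

Lemma N_bounded : bounded_map N.
Proof. by have [Wl Wb _] := W_wco; exact: (bounded_inverse Wl Wb WN NW). Qed.

Lemma eval_N_bounded y : exists M : R, forall f : H1, rnorm (hfs_fun (N f) y) <= M * rnorm f.
Proof.
have [M1 h1] := (bounded_mapP _).1 N_bounded.
have [M2 h2] := (bounded_mapP (fun g : H2 => hfs_fun g y)).1 (hfs_fun_bounded H2 y).
exists (`|M2| * M1) => f; apply: le_trans (h2 _) _.
apply: le_trans (ler_wpM2r (rnorm_ge0 _) (ler_norm M2)) _.
by rewrite -mulrA; apply: ler_wpM2l.
Qed.

Lemma eval_N_lin y (a : C) (f g : H1) :
  hfs_fun (N (a *: f + g)) y = a * hfs_fun (N f) y + hfs_fun (N g) y.
Proof. by rewrite N_linear hfs_fun_linear. Qed.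

(** If [f0 y = 0], then [(N p) ^ 2 = N (p ^ 2) * f0] vanishes at [y] for every
    polynomial [p]; by density and boundedness so does [N f] for every [f] in
    [H1], in particular for [f = W 1]. *)
Lemma weight_reciprocal_neq0 (f0 : H2) (y : X2) :
  (forall x, lambda x * hfs_fun f0 (phi x) = 1) -> hfs_fun f0 y != 0.
Proof.
move=> f0E; apply/eqP => f0y.
have poly0 (f : H1) p : hfs_fun f = poly_fun p -> hfs_fun (N f) y = 0.
  move=> fp; have [q qE] := @poly_fun_sqr R d X1 p; have [g gE] := H1_polynomials q.
  have hE x : hfs_fun g x = hfs_fun f x * hfs_fun f x by rewrite gE fp qE.
  have := product_identity_range (inverse_wco_products W_wco NW H1_polynomials hE f0E) y.
  by rewrite f0y mulr0 => /eqP; rewrite mulf_eq0 orbb => /eqP.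
have [M hM] := eval_N_bounded y.
have all0 (f : H1) : hfs_fun (N f) y = 0.
  apply: rnorm_eq0; apply/eqP; rewrite eq_le rnorm_ge0 andbT.
  apply/ler_addgt0Pr => e e0; rewrite add0r.
  pose K := `|M| + 1; have K0 : 0 < K by rewrite /K; have := normr_ge0 M; lra.
  have [||g [/= gf [p gp]]] := H1_dense (O := [set g | rnorm (g - f) < e / K]).
  - by exists f => /=; rewrite subrr rnorm0 divr_gt0.
  - exact: open_rball.
  have -> : hfs_fun (N f) y = - hfs_fun (N (-1 *: f + g)) y.
    by rewrite eval_N_lin (poly0 g p gp) addr0 mulN1r opprK.
  rewrite rnormN; apply: le_trans (hM _) _; rewrite scaleN1r addrC.
  have MK : M <= K by rewrite /K; have := ler_norm M; lra.
  apply: le_trans (ler_wpM2r (rnorm_ge0 _) MK) _.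
  by rewrite -ler_pdivlMl// mulrC ltW.
have [one oneE] := H2_constants 1.
by have := all0 (W one); rewrite WN oneE => /eqP; rewrite oner_eq0.
Qed.

(** Evaluation at [y], transported to [H1] and normalized by [f0 y], is a
    multiplicative functional, hence evaluation at some [x] of [X1]. *)
Lemma phi_surjective y : exists x, phi x = y.
Proof.
have [f0 f0E] := weight_reciprocal W_wco NW H1_polynomials.
have f0y := weight_reciprocal_neq0 y f0E.
pose rho (f : H1) : C := hfs_fun (N f) y / hfs_fun f0 y.
have rho_lin : linear rho.
  by move=> a f g; rewrite /rho eval_N_lin mulrDl -mulrA.
pose rhoM := GRing.isLinear.Build _ _ _ _ rho rho_lin.
pose rhoL : {linear H1 -> C} := HB.pack rho rhoM.
have [M hM] := eval_N_bounded y.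
have [|x hx] := H1_max (rho := rhoL).
  split.
  - apply/bounded_mapP; exists (M / rnorm (hfs_fun f0 y)) => f.
    rewrite /= /rho rnormM rnormV mulrAC ler_pM2r ?invr_gt0 ?rnorm_gt0//.
  - have [one oneE] := H2_constants 1; exists (W one).
    by rewrite /= /rho WN oneE mul1r invr_eq0.
  move=> f g h hE /=; rewrite /rho.
  have := product_identity_range (inverse_wco_products W_wco NW H1_polynomials hE f0E) y.
  by move=> E; rewrite mulrACA E -!mulrA [X in _ = _ * X]mulrA divff// mul1r.
have [_ _ WE] := W_wco.
have key (f : H2) : hfs_fun f y / hfs_fun f0 y = lambda x * hfs_fun f (phi x).
  by have := hx (W f); rewrite /= /rho WN WE.
have [one oneE] := H2_constants 1.
have lx : lambda x = (hfs_fun f0 y)^-1.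
  by have := key one; rewrite oneE mulr1 mul1r => ->.
have same (f : H2) : hfs_fun f y = hfs_fun f (phi x).
  apply: (mulIf (x := (hfs_fun f0 y)^-1)); first by rewrite invr_eq0.
  by rewrite key lx mulrC.
exists x; apply: set_val_inj; apply/rowP => i.
have [c cE] := H2_coordinates i.
by have := same c; rewrite cE.
Qed.

End Surjectivity.

Theorem proposition4p13 (R : realType) (d1 d2 : nat)
    (X1 : set 'rV[Cplx R]_d1) (X2 : set 'rV[Cplx R]_d2)
    (H1 : hilbertFunctionSpace R X1) (H2 : hilbertFunctionSpace R X2)
    (X1_nonempty : X1 !=set0) (X2_nonempty : X2 !=set0)
    (H1_two_interpolating : two_interpolating H1)
    (H2_two_interpolating : two_interpolating H2)
    (H1_maximal_domain : maximal_domain H1)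
    (H2_maximal_domain : maximal_domain H2)
    (X1_int_connected : connected X1°)
    (X2_int_connected : connected X2°)
    (X1_int_dense : X1 `<=` closure X1°)
    (X2_int_dense : X2 `<=` closure X2°)
    (H1_holomorphic : forall f : H1, holomorphic_on_interior (hfs_fun f))
    (H2_holomorphic : forall f : H2, holomorphic_on_interior (hfs_fun f))
    (H1_continuous : forall f : H1, continuous (hfs_fun f))
    (H2_continuous : forall f : H2, continuous (hfs_fun f))
    (H1_polynomials : forall p : mpoly.mpoly d1 (Cplx R),
       exists f : H1, hfs_fun f = poly_fun p)
    (H1_polynomials_dense :
       dense [set f : H1 | exists p : mpoly.mpoly d1 (Cplx R),
                             hfs_fun f = poly_fun p])
    (H2_constants : forall c : Cplx R, exists f : H2, hfs_fun f = fun=> c)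
    (H2_coordinates : forall i : 'I_d2,
       exists f : H2, hfs_fun f = coord_fun i)
    (d2_le_d1 : (d2 <= d1)%N)
    (lambda : X1 -> Cplx R) (phi : X1 -> X2) (W : H2 -> H1)
    (W_wco : weighted_composition_operator lambda phi W)
    (W_bijective : bijective W) :
  [/\ d1 = d2,
      [/\ bijective phi,
          holomorphic_on_interior (fun x : X1 => set_val (phi x)) &
          continuous phi] &
      (forall x : X1, lambda x != 0) /\
      exists (psi : X2 -> X1) (Winv : H1 -> H2),
        [/\ cancel phi psi, cancel psi phi, cancel W Winv, cancel Winv W &
            weighted_composition_operator
              (fun y : X2 => (lambda (psi y))^-1) psi Winv]].
Proof.
have [N WN NW] := W_bijective.
have X1_int : X1° !=set0.
  have [x X1x] := X1_nonempty.
  have [z [Xz _]] := X1_int_dense x X1x setT filterT.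
  by exists z.
have dE : d1 = d2.
  apply/eqP; rewrite eqn_leq d2_le_d1 andbT.
  have [F [z [c [_ _ _ c0 hc]]]] := phi_nonsingular W_wco NW H1_polynomials
    H1_holomorphic H2_continuous H2_constants H2_coordinates X1_int.
  exact: (bounded_below_dim c0 hc).
subst d2.
have surj y : exists x, phi x = y.
  exact: (phi_surjective W_wco WN NW H1_polynomials X1_int H1_holomorphic
    H2_holomorphic H2_continuous H2_constants H2_coordinates X2_int_connected
    X2_int_dense H1_polynomials_dense H1_maximal_domain).
have [psi psiK] := choice surj.
have inj := phi_inj W_wco NW H1_polynomials.
have phiK : cancel phi psi by move=> x; apply: inj; rewrite psiK.
have l0 := weight_neq0 W_wco NW H1_polynomials.
have [W_lin W_bd _] := W_wco.
split => //.
  split; first by exists psi.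
  - exact: (phi_holomorphic W_wco NW H1_polynomials H1_holomorphic
      H2_constants H2_coordinates).
  - exact: (phi_continuous W_wco NW H1_polynomials H1_continuous
      H2_constants H2_coordinates).
split => //; exists psi, N; split => //; split.
- exact: (inverse_linear W_lin WN NW).
- exact: (bounded_inverse W_lin W_bd WN NW).
move=> f y; apply: (mulfI (l0 (psi y))).
by rewrite mulrA divff// mul1r -(inverse_wcoE W_wco NW f (psi y)) psiK.
Qed.
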